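(* Let $p>1$ be a real number, let $a,b:\mathbb{Z}\to(0,+\infty)$, and let $f:\mathbb{Z}\times\mathbb{R}\to\mathbb{R}$ be continuous (i.e. $f(k,\cdot)$ is continuous for each $k\in\mathbb{Z}$). Put $F(k,t)=\int_0^t f(k,s)\,ds$ and $\mathcal{F}(k,t)=f(k,t)t-pF(k,t)$ for $k\in\mathbb{Z}$, $t\in\mathbb{R}$. Suppose that: (B) there is $b_0>0$ such that $b(k)\ge b_0$ for all $k\in\mathbb{Z}$, and $b(k)\to+\infty$ as $|k|\to+\infty$; (H1) $f(k,-t)=-f(k,t)$ for all $k\in\mathbb{Z}$ and $t\in\mathbb{R}$; (H2) there exist $d>0$ and $q>p$ such that $|F(k,t)|\le d\left(|t|^p+|t|^q\right)$ for all $k\in\mathbb{Z}$ and $t\in\mathbb{R}$; (H3) $\lim_{t\to 0}\frac{f(k,t)}{|t|^{p-1}}=0$ uniformly for all $k\in\mathbb{Z}$; (H4) $\lim_{|t|\to+\infty}\frac{f(k,t)t}{|t|^p}=+\infty$ for all $k\in\mathbb{Z}$; (H5) there exists $\sigma\ge 1$ such that $\sigma\mathcal{F}(k,t)\ge\mathcal{F}(k,st)$ for all $k\in\mathbb{Z}$, $t\in\mathbb{R}$ and $s\in[0,1]$. Then, for any $\lambda>0$, there is a sequence $\{u_n\}_{n}$ of elements of $X$ such that each $u_n$ is a solution of the problem $$-\Delta\left(a(k)\phi_p(\Delta u(k-1))\right)+b(k)\phi_p(u(k))=\lambda f(k,u(k))\ \text{ for all } k\in\mathbb{Z},\qquad u(k)\to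 0 \text{ as } |k|\to\infty,$$ and $J_\lambda(u_n)\to\infty$ as $n\to\infty$.
   Context: Here $\phi_p(t)=|t|^{p-2}t$ for $t\in\mathbb{R}$ (with $\phi_p(0)=0$), and $\Delta$ is the forward difference operator: $\Delta u(k-1)=u(k)-u(k-1)$; more generally $\Delta v(k)=v(k+1)-v(k)$, so the first term of the equation is minus the forward difference, evaluated at $k$, of the sequence $k\mapsto a(k)\phi_p(\Delta u(k-1))$. The space $X$ is the set of all $u:\mathbb{Z}\to\mathbb{R}$ with $\sum_{k\in\mathbb{Z}}\left[a(k)|\Delta u(k-1)|^p+b(k)|u(k)|^p\right]<\infty$, normed by $\|u\|=\left(\sum_{k\in\mathbb{Z}}\left[a(k)|\Delta u(k-1)|^p+b(k)|u(k)|^p\right]\right)^{1/p}$. The functional $J_\lambda:X\to\mathbb{R}$ is $$J_\lambda(u)=\frac1p\sum_{k\in\mathbb{Z}}\left[a(k)|\Delta u(k-1)|^p+b(k)|u(k)|^p\right]-\lambda\sum_{k\in\mathbb{Z}}F(k,u(k)).$$ *)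

(* Defs.v *)
(* World: MathComp-Analysis *)
From HB Require Import structures.
From mathcomp Require Import all_boot all_order all_algebra.
From mathcomp Require Import all_classical all_reals all_analysis.
Import Order.TTheory GRing.Theory Num.Theory.
Import numFieldNormedType.Exports.

Set Implicit Arguments.
Unset Strict Implicit.
Unset Printing Implicit Defensive.

Local Open Scope classical_set_scope.
Local Open Scope ring_scope.

(* The filter "|x| -> +oo"; used both at T := int and at T := R. *)
Definition abs_infty (T : realDomainType) : set_system T :=
  filter_from [set: T] (fun M => [set x | M < `|x|]).
Arguments abs_infty T : clear implicits.

Instance abs_infty_proper (T : realDomainType) : ProperFilter (abs_infty T).
Proof.
apply: filter_from_proper => [|M _].
- apply: filter_from_filter => [|M N _ _]; first by exists 0.
  by exists (Num.max M N) => // x /=; rewrite gt_max => /andP[].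
- exists (`|M| + 1) => /=; rewrite ger0_norm ?addr_ge0//.
  by rewrite (le_lt_trans (ler_norm M))// ltrDl.
Qed.

Section Definitions.
Context {R : realType}.

(* |t|^(p-2) t; at t = 0 the second factor makes it 0. *)
Definition phi (p t : R) : R := `|t| `^ (p - 2) * t.

Definition Delta (v : int -> R) (k : int) : R := v (k + 1) - v k.

(* Oriented integral of g from 0 to t. *)
Definition integral0 (g : R -> R) (t : R) : R :=
  if 0 <= t then \int[lebesgue_measure]_(s in `[0, t]) g s
  else - \int[lebesgue_measure]_(s in `[t, 0]) g s.

Definition primF (f : int -> R -> R) (k : int) (t : R) : R :=
  integral0 (f k) t.

Definition calF (p : R) (f : int -> R -> R) (k : int) (t : R) : R :=
  f k t * t - p * primF f k t.

(* \esum is only meaningful for nonnegative terms, so the sum of a signed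
   family is taken as the difference of the sums of its positive and negative
   parts; this is the usual sum when the family is absolutely summable. *)
Definition zsum (g : int -> R) : R :=
  fine (\esum_(k in [set: int]) (g^\+ k)%:E)
  - fine (\esum_(k in [set: int]) (g^\- k)%:E).

(* The p-th power of the norm of the space spaceX. *)
Definition energy (p : R) (a b : int -> R) (u : int -> R) : \bar R :=
  \esum_(k in [set: int])
    (a k * `|Delta u (k - 1)| `^ p + b k * `|u k| `^ p)%:E.

Definition spaceX (p : R) (a b : int -> R) : set (int -> R) :=
  [set u | (energy p a b u < +oo)%E].

(* Finite, hence meaningful, for u in spaceX p a b and (k |-> primF f k (u k))
   absolutely summable. *)
Definition J (p : R) (a b : int -> R) (f : int -> R -> R) (lambda : R)
    (u : int -> R) : R :=
  p^-1 * fine (energy p a b u) - lambda * zsum (fun k => primF f k (u k)).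

Definition is_solution (p : R) (a b : int -> R) (f : int -> R -> R)
    (lambda : R) (u : int -> R) : Prop :=
  (forall k : int,
     - Delta (fun j => a j * phi p (Delta u (j - 1))) k + b k * phi p (u k)
     = lambda * f k (u k))
  /\ u k @[k --> abs_infty int] --> (0 : R).

End Definitions.

(* Main.v *)
Require Import Defs.
From HB Require Import structures.
From mathcomp Require Import all_boot all_order all_algebra.
From mathcomp Require Import all_classical all_reals all_analysis.
From mathcomp Require Import zify ring lra.
Import Order.TTheory GRing.Theory Num.Theory.
Import numFieldNormedType.Exports.

Set Implicit Arguments.
Unset Strict Implicit.
Unset Printing Implicit Defensive.

(** Solutions are the critical points of an even functional.  They are found at
    arbitrarily high levels by a Lyusternik-Schnirelmann argument on finite
    windows of sites, followed by a passage to the limit.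

    On the sequences supported in the window |k| <= n the functional [Jwin]
    tends to -oo at infinity, because F(k, t) / |t|^p -> +oo.  Its superlevel
    sets are therefore bounded, and gradient ascent with a fixed small step
    carries {M <= Jwin} into {C <= Jwin} after finitely many steps, unless there
    are almost critical points at a level between M and C + 1 ([ascent]).
    The ascent map is odd and continuous.  It is applied to a cube, of
    dimension one less than the number of sites K < |k| <= n, embedded in the
    sequences that live on those sites and have sup norm between d / 2 and d; b
    is large there, so Jwin >= M on this cube, with M -> +oo as K -> +oo.  By
    the Borsuk-Ulam theorem some point of the cube is sent to a sequence
    supported in |k| <= K + 1.  On such sequences Jwin is bounded above by a
    constant which depends on K only, and a larger C is impossible.  So every
    window n > K has almost critical points between M and a level independent
    of n ([almost_critical_points]).

    The assumption sigma calF(k, t) >= calF(k, s t) says that along the segment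
    from 0 to u the functional is controlled by its value at u and by its
    derivative along u ([Jwin_ray]).  With the superlinearity of F this bounds
    the energy of the almost critical points uniformly in n ([energy_bound]).
    Since b -> +oo, a bound on the energy makes the tails uniformly small, so a
    pointwise limit along an ultrafilter keeps the level: it is a solution of
    finite energy, and J is at least about M there ([solution_above]).

    The Borsuk-Ulam theorem is deduced from a version of Tucker's lemma on
    integer grids, proved by a parity count. *)

(** * Tucker's lemma on integer grids *)

Lemma odd_card_involution (T : finType) (A : {set T}) (f : T -> T) :
  {in A, forall x, [/\ f x \in A, f (f x) = x & f x != x]} -> ~~ odd #|A|.
Proof.
move: {2}#|A|.+1 (ltnSn #|A|) => m; elim: m A => // m IH A Am fA.
have [->|[x xA]] := set_0Vmem A; first by rewrite cards0.
have [fxA ffx fxx] := fA x xA.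
have fxAx : f x \in A :\ x by rewrite !inE fxx.
rewrite (cardsD1 x) xA (cardsD1 (f x)) fxAx /= negbK.
have cA : #|A| = #|A :\ x :\ f x|.+2.
  by rewrite (cardsD1 x) xA (cardsD1 (f x)) fxAx.
apply: IH => [|y]; first by lia.
rewrite !inE => /and3P[yfx yx yA]; have [fyA ffy fyy] := fA y yA.
split=> //; rewrite fyA andbT; apply/andP; split.
  by apply: contra_neq yx => e; rewrite -ffy e ffx.
by apply: contra_neq yfx => e; rewrite -ffy e.
Qed.

Lemma perm_cons_inj (T : eqType) (x y : T) s :
  perm_eq (x :: s) (y :: s) -> x = y.
Proof.
move=> /permP/(_ (pred1 x)) /=; rewrite eqxx eq_sym.
by case: eqP => // _ /eqP; rewrite eqn_add2r.
Qed.

Lemma perm_iota_last k : perm_eq (rem k (iota 0 k.+1)) (iota 0 k).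
Proof.
rewrite -(perm_cons k) perm_sym.
apply: perm_trans (perm_to_rem _); last by rewrite mem_iota /=; lia.
by rewrite -[k.+1]addn1 iotaD add0n cats1 perm_sym perm_rcons.
Qed.

Definition swap_at (T : Type) (j : nat) (s : seq T) :=
  take j.-1 s ++ rev (take 2 (drop j.-1 s)) ++ drop j.+1 s.

Lemma swap_at_cat (T : Type) (A B : seq T) x y :
  swap_at (size A).+1 (A ++ x :: y :: B) = A ++ y :: x :: B.
Proof.
rewrite /swap_at /= take_size_cat// drop_size_cat//= take0.
have -> : (size A).+2 = size [:: x; y] + size A by [].
by rewrite -drop_drop drop_size_cat//= drop0.
Qed.

Lemma split_at (T : Type) (j : nat) (s : seq T) : 0 < j < size s ->
  exists A x y B, s = A ++ x :: y :: B /\ j = (size A).+1.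
Proof.
move=> /andP[j0 js].
have [x0 _] : exists x0 : T, True by case: s js => [|x0 s]//= _; exists x0.
exists (take j.-1 s), (nth x0 s j.-1), (nth x0 s j), (drop j.+1 s).
have j1 : (j.-1 < size s)%N by lia.
split; last by rewrite size_take j1 prednK.
rewrite -(drop_nth x0 js).
have -> : drop j s = drop j.-1.+1 s by rewrite prednK.
by rewrite -(drop_nth x0 j1) cat_take_drop.
Qed.

(** The cube [-N-1, N+1]^I is triangulated so that every coordinate orthant is a
    union of simplices.  A simplex of dimension k is given by a base point z and
    a list s of k signed directions: the signs in s tell the orthant, the order
    of s tells the order in which the steps are taken from the base point, and
    the coordinates off s vanish.  A label is itself a signed direction, so that
    the list s doubles as the set of labels wanted on a facet of the simplex
    (z, s).  A facet which carries exactly the labels in s is a door.  The doors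
    are counted modulo 2 in two ways: room by room, and by the two rooms of the
    same orthant that share the door. *)
Section Tucker.
Variables (I : finType) (N : nat) (l : {ffun I -> int} -> I * bool).
Local Notation n := #|I|.
Local Open Scope ring_scope.

Definition flip (x : I * bool) : I * bool := (x.1, ~~ x.2).
Definition in_grid (v : {ffun I -> int}) := forall i, `|v i| <= N.+1%:Z.

Hypothesis l_adj : forall v w : {ffun I -> int}, in_grid v -> in_grid w ->
  (forall i, `|v i - w i| <= 1) -> l w <> flip (l v).
Hypothesis l_anti : forall v : {ffun I -> int}, in_grid v ->
  (exists i, `|v i| = N.+1%:Z) -> l [ffun i => - v i] = flip (l v).

Implicit Types (z : {ffun I -> 'I_N.+1}) (s A : seq (I * bool)).

(** The vertex of the simplex (z, s) reached by the steps in the directions A. *)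
Definition corner z s A : {ffun I -> int} :=
  [ffun i => (((i, true) \in s)%:Z - ((i, false) \in s)%:Z)
              * ((z i)%:Z + (i \in unzip1 A)%:Z)].

Definition label z s (j : nat) := l (corner z s (drop j s)).

(** Vanishing of z off the support of s makes the encoding of a simplex unique. *)
Definition room_ok z s :=
  uniq (unzip1 s) && [forall i, (i \notin unzip1 s) ==> (z i == ord0)].

(** The facet opposite to the vertex j carries exactly the labels s. *)
Definition door_ok z s j :=
  (j <= size s)%N && perm_eq [seq label z s i | i <- rem j (iota 0 (size s).+1)] s.

Definition room : Type := ({ffun I -> 'I_N.+1} * n.-bseq (I * bool))%type.
HB.instance Definition _ := Finite.on room.

Definition doors : {set room * 'I_n.+1} :=
  [set q : room * 'I_n.+1 | room_ok q.1.1 q.1.2 & door_ok q.1.1 q.1.2 q.2].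

(** A room whose labels are those in s and one more, x, is a facet with the
    labels x :: s of the simplex (z, x :: s), one dimension higher. *)
Definition exits : {set room} :=
  [set r : room | room_ok r.1 r.2 & [exists x, (x \notin val r.2) &&
    perm_eq [seq label r.1 r.2 i | i <- iota 0 (size r.2).+1] (x :: r.2)]].

Lemma uniq_unzip1 s : uniq (unzip1 s) -> uniq s.
Proof. exact: map_uniq. Qed.

Lemma door_okE z s j : (j <= size s)%N -> door_ok z s j =
  perm_eq [seq label z s i | i <- iota 0 (size s).+1] (label z s j :: s).
Proof.
move=> js; rewrite /door_ok js /=.
have jI : j \in iota 0 (size s).+1 by rewrite mem_iota; lia.
rewrite (permPl (perm_map (label z s) (perm_to_rem jI))).
by rewrite [in RHS]map_cons perm_cons.
Qed.

(** If the labels of a room are x together with those in s, its doors are the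
    facets opposite to the vertices labelled x: one if x is not in s, and two
    otherwise, because s has no repetition. *)
Lemma odd_doors_room z (s : n.-bseq (I * bool)) : room_ok z s ->
  odd #|[set j : 'I_n.+1 | door_ok z s j]| = ((z, s) \in exits).
Proof.
move=> ok; rewrite inE ok /=.
set W := [seq label z s i | i <- iota 0 (size s).+1].
have us : uniq s by apply: uniq_unzip1; case/andP: ok.
have [x Wx|noW] := pickP (fun x => perm_eq W (x :: s)); last first.
  have -> : [set j : 'I_n.+1 | door_ok z s j] = finset.set0.
    apply/setP => j; rewrite !inE; apply/negbTE/negP => dj.
    have js : (j <= size s)%N by case/andP: dj.
    by move: dj; rewrite door_okE// noW.
  rewrite cards0; apply/esym/existsP => -[x /andP[_]].
  by rewrite [perm_eq _ _]noW.
have -> : [exists y, (y \notin val s) && perm_eq W (y :: s)] = (x \notin val s).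
  apply/existsP/idP => [[y /andP[ys Wy]]|xs]; last by exists x; rewrite xs.
  suff -> : x = y by [].
  apply: (@perm_cons_inj _ _ _ (val s)); apply: perm_trans Wy.
  by rewrite perm_sym.
have dE (j : 'I_n.+1) : door_ok z s j = (j < (size s).+1)%N && (label z s j == x).
  rewrite ltnS; have [js|js] := leqP j (size s); last by rewrite /door_ok leqNgt js.
  rewrite door_okE//=; apply/idP/eqP => [Wj|->]; last exact: Wx.
  apply: (@perm_cons_inj _ _ _ (val s)); apply: perm_trans Wx.
  by rewrite perm_sym.
have -> : #|[set j : 'I_n.+1 | door_ok z s j]| = count_mem x W.
  rewrite -sum1_card (eq_bigl (fun j : 'I_n.+1 => (j < (size s).+1)%N
      && (label z s j == x))) => [|j]; last by rewrite inE dE.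
  rewrite (eq_bigl (fun j : 'I_n.+1 => (label z s j == x) && (j < (size s).+1)%N));
    last by move=> j; rewrite andbC.
  rewrite -(@big_ord_widen_cond _ _ _ (size s).+1 n.+1 (fun j => label z s j == x)
    (fun=> 1%N)); last by have := size_bseq s; lia.
  rewrite -(big_mkord (fun j => label z s j == x) (fun=> 1%N)).
  by rewrite sum1_count count_map /index_iota subn0.
have /permP/(_ (pred1 x))/= -> := Wx.
rewrite eqxx (count_uniq_mem _ us) add1n /=.
by case: (x \in _).
Qed.

Lemma odd_doors : odd #|doors| = odd #|exits|.
Proof.
have -> : #|doors| = (\sum_(r : room) #|[set j : 'I_n.+1 | (r, j) \in doors]|)%N.
  rewrite -sum1_card (eq_bigr (fun r : room =>
    \sum_(j : 'I_n.+1 | (r, j) \in doors) 1)%N) => [|r _]; last first.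
    by rewrite -sum1_card; apply: eq_bigl => j; rewrite inE.
  by rewrite pair_big_dep; apply: eq_bigl => -[r j].
rewrite -sum1_card [in RHS]big_mkcond !(big_morph odd oddD (erefl : odd 0 = false)).
apply: eq_bigr => -[z s] _.
have [ok|nok] := boolP (room_ok z s).
  have -> : [set j : 'I_n.+1 | ((z, s), j) \in doors] = [set j : 'I_n.+1 | door_ok z s j].
    by apply/setP => j; rewrite !inE /= ok.
  by rewrite odd_doors_room//; case: ifP.
have -> : [set j : 'I_n.+1 | ((z, s), j) \in doors] = finset.set0.
  by apply/setP => j; rewrite !inE /= (negbTE nok).
by rewrite cards0 !inE /= (negbTE nok).
Qed.

Lemma corner_eq z z' s s' A A' : s =i s' ->
  (forall i, z i + (i \in unzip1 A) = z' i + (i \in unzip1 A') :> nat)%N ->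
  corner z s A = corner z' s' A'.
Proof.
by move=> ss zz; apply/ffunP => i; rewrite !ffunE !ss -!PoszD zz.
Qed.

Lemma mem_unzip1_perm s s' : perm_eq s s' -> unzip1 s =i unzip1 s'.
Proof. by move=> /(perm_map fst)/perm_mem. Qed.

Lemma room_ok_perm z s s' : perm_eq s s' -> room_ok z s = room_ok z s'.
Proof.
move=> ss; rewrite /room_ok (perm_uniq (perm_map fst ss)); congr (_ && _).
by apply: eq_forallb => i; rewrite (mem_unzip1_perm ss).
Qed.

(** A facet opposite to an intermediate vertex is shared with the simplex in
    which the two steps around that vertex are taken in the other order. *)
Lemma door_swap z A x y B (s := A ++ x :: y :: B) (s' := A ++ y :: x :: B)
    (j := (size A).+1) :
  room_ok z s = room_ok z s' /\ door_ok z s j = door_ok z s' j.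
Proof.
have ss : perm_eq s s'.
  by rewrite perm_cat2l -[x :: y :: B]/([:: x] ++ [:: y] ++ B) perm_catCA.
split; first exact: room_ok_perm.
rewrite /door_ok (perm_size ss) (permPr ss); congr (_ && perm_eq _ _).
apply/eq_in_map => i; rewrite mem_rem_uniq ?iota_uniq// inE => /andP[ij _].
congr (l _); apply: corner_eq => [|k]; first exact: perm_mem.
congr (_ + _)%N; rewrite /s /s' !drop_cat; case: ltnP => iA.
  rewrite /unzip1 !map_cat !mem_cat /= !inE.
  by congr (nat_of_bool (_ || _)); rewrite orbCA.
have [->|iA'] := eqVneq i (size A).
  by rewrite subnn /= !inE; congr (nat_of_bool _); rewrite orbCA.
suff -> : (i - size A = (i - size A - 2).+2)%N by [].
by move: ij; rewrite /j; lia.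
Qed.

(** A facet opposite to the last vertex is shared with the translate of the
    simplex in which the first step becomes the last one. *)
Lemma door_shift z z' x t : uniq (unzip1 (x :: t)) ->
  (forall i, z i = z' i + (i == x.1) :> nat)%N ->
  room_ok z (x :: t) = room_ok z' (rcons t x) /\
  door_ok z (x :: t) 0 = door_ok z' (rcons t x) (size t).+1.
Proof.
move=> /= /andP[xt _] zz.
have ss : perm_eq (x :: t) (rcons t x) by rewrite perm_sym perm_rcons.
split.
  rewrite (room_ok_perm _ ss) /room_ok; congr (_ && _).
  apply: eq_forallb => i; rewrite -(mem_unzip1_perm ss) inE negb_or.
  have [//|ix] := eqVneq i x.1; congr (_ ==> _).
  by rewrite -!val_eqE /= zz (negbTE ix) addn0.
rewrite /door_ok size_rcons leqnn leq0n !andTb (permPr ss).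
rewrite (permPl (perm_map (label z' (rcons t x)) (perm_iota_last _))).
have -> : rem 0%N (iota 0 (size (x :: t)).+1) = map (addn 1) (iota 0 (size t).+1).
  by rewrite -iotaDl.
rewrite -map_comp; congr (perm_eq _ _).
apply/eq_in_map => i; rewrite mem_iota /= add0n ltnS => it.
congr (l _); apply: corner_eq => [k|k /=]; first exact: perm_mem.
rewrite drop_rcons// (mem_unzip1_perm (_ : perm_eq (rcons (drop i t) x) (x :: drop i t))).
  rewrite /= inE zz -addnA; congr (_ + _)%N; case: eqVneq => [->|//].
  suff -> : (x.1 \in unzip1 (drop i t)) = false by []. apply: (contraNF _ xt).
  by move=> /mapP[y yt ->]; apply: map_f; exact: mem_drop yt.
by rewrite perm_rcons.
Qed.

(** The facet lies in a coordinate hyperplane bounding the orthant. *)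
Definition inner (q : room * 'I_n.+1) :=
  if val q.1.2 is x :: _ then (q.2 == 0%N :> nat) && (q.1.1 x.1 == 0%N :> nat) else false.
(** The facet lies in the boundary of the cube. *)
Definition outer (q : room * 'I_n.+1) :=
  if rev (val q.1.2) is x :: _ then (q.2 == size q.1.2 :> nat) && (q.1.1 x.1 == N :> nat) else false.
(** The simplex is the origin, whose only facet is empty. *)
Definition start (q : room * 'I_n.+1) := nilp (val q.1.2).

Definition set_coord z (h : I) (k : nat) : {ffun I -> 'I_N.+1} :=
  [ffun i => if i == h then inord k else z i].

Definition pivot (q : room * 'I_n.+1) : room * 'I_n.+1 :=
  let z := q.1.1 in let s := val q.1.2 in let j := q.2 in
  if j == 0%N :> nat then
    if s is x :: t then ((set_coord z x.1 (z x.1).-1, insub_bseq n (rcons t x)), inord (size s))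
    else q
  else if j == size s :> nat then
    if rev s is x :: t then ((set_coord z x.1 (z x.1).+1, insub_bseq n (x :: rev t)), ord0)
    else q
  else ((z, insub_bseq n (swap_at j s)), j).

Lemma insub_bseqE (T : Type) m (s : seq T) : (size s <= m)%N -> insub_bseq m s = s :> seq T.
Proof. by move=> sm; rewrite /insub_bseq insubdK. Qed.

Lemma set_coord_pred z h : (0 < z h)%N ->
  forall i, (z i = set_coord z h (z h).-1 i + (i == h) :> nat)%N.
Proof.
move=> zh i; rewrite ffunE; case: eqVneq => [->|]; last by rewrite addn0.
by rewrite inordK ?addn1 ?prednK// ltnW// ltnS.
Qed.

Lemma set_coord_succ z h : (z h < N)%N ->
  forall i, (set_coord z h (z h).+1 i = z i + (i == h) :> nat)%N.
Proof.
move=> zh i; rewrite ffunE; case: eqVneq => [->|]; last by rewrite addn0.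
by rewrite inordK ?addn1.
Qed.

Lemma set_coordK z h k m : z h = m :> nat -> set_coord (set_coord z h k) h m = z.
Proof.
move=> zh; apply/ffunP => i; rewrite !ffunE; case: eqVneq => // ->.
by apply/val_inj; rewrite /= inordK ?zh// -zh.
Qed.

Lemma room_eq (z z' : {ffun I -> 'I_N.+1}) (s s' : n.-bseq (I * bool)) (j j' : 'I_n.+1) :
  z = z' -> s = s' :> seq _ -> j = j' :> nat -> ((z, s), j) = ((z', s'), j') :> room * 'I_n.+1.
Proof. by move=> -> /val_inj-> /val_inj->. Qed.

Definition inside := [set q in doors | [&& ~~ start q, ~~ inner q & ~~ outer q]].

Lemma pivotP q : q \in inside ->
  [/\ pivot q \in inside, pivot (pivot q) = q & pivot q != q].
Proof.
case: q => -[z s] j; have sn := size_bseq s; have jn := ltn_ord j.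
rewrite !inE /= -andbA => /and5P[ok /andP[js dj] ns ni no].
have dk : door_ok z s j by rewrite /door_ok js.
move: ni no; rewrite /inner /outer /=.
have [j0|j0] := eqVneq (j : nat) 0%N.
- move: ns; rewrite /start /=; case es: (val s) => [//|x t] _ zx _.
  rewrite /= in zx; move: js dj dk sn ok; rewrite es j0 => _ _ dk sn ok.
  have zx0 : (0 < z x.1)%N by rewrite lt0n.
  have us : uniq (unzip1 (x :: t)) by case/andP: ok.
  have [okE dkE] := door_shift us (set_coord_pred zx0).
  set z' := set_coord _ _ _ in okE dkE.
  have sz : (size (rcons t x) <= n)%N by rewrite size_rcons.
  have pE : pivot ((z, s), j) = ((z', insub_bseq n (rcons t x)), inord (size t).+1).
    by rewrite /pivot /= j0 es.
  have jE : (inord (size t).+1 : 'I_n.+1) = (size t).+1 :> nat.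
    by rewrite inordK// ltnS.
  rewrite pE /start /inner /outer /= insub_bseqE// jE size_rcons eqxx.
  rewrite -okE ok -dkE dk rev_rcons /=; split.
  + have -> : nilp (rcons t x) = false by rewrite /nilp size_rcons.
    have -> : (if rcons t x is y :: _ then false && (z' y.1 == 0%N :> nat) else false) = false.
      by case: (rcons t x).
    rewrite /= /z' ffunE eqxx inordK; last by have := ltn_ord (z x.1); lia.
    by have := ltn_ord (z x.1); move: zx0; lia.
  + rewrite /pivot /= insub_bseqE// jE size_rcons eqxx rev_rcons revK.
    apply: room_eq => //; last by rewrite insub_bseqE.
    have -> : (z' x.1).+1 = z x.1 :> nat.
      by rewrite (set_coord_pred zx0) eqxx addn1.
    exact: set_coordK.
  + by apply/eqP => -[_ _ /(congr1 val)]; rewrite /= jE j0.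
have [jE|jE] := eqVneq (j : nat) (size s).
- have [t [x es]] : exists t x, val s = rcons t x.
    by move: ns; rewrite /start /=; case/lastP: (val s) => // t x _; exists t, x.
  rewrite es rev_rcons /= => _ zx.
  move: js dj dk sn ok j0; rewrite jE es => _ _; rewrite size_rcons => dk sn ok j0.
  have zxN : (z x.1 < N)%N by have := ltn_ord (z x.1); move: zx; lia.
  have us : uniq (unzip1 (x :: t)).
    have [us _] := andP ok.
    by move: us; rewrite /unzip1 map_rcons rcons_uniq.
  have [okE dkE] := door_shift us (set_coord_succ zxN).
  set z' := set_coord _ _ _ in okE dkE.
  have pE : pivot ((z, s), j) = ((z', insub_bseq n (x :: t)), ord0).
    by rewrite /pivot /= jE es size_rcons /= eqxx rev_rcons revK.
  rewrite pE /start /inner /outer /= insub_bseqE// okE ok dkE dk /=; split.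
  + have -> : (if rev (x :: t) is y :: _ then (0%N == (size t).+1) && (z' y.1 == N :> nat) else false) = false.
      by case: (rev _).
    by rewrite (set_coord_succ zxN) eqxx addn1.
  + rewrite /pivot /= insub_bseqE//.
    apply: room_eq => //; last by rewrite inordK// jE es size_rcons.
    have -> : (z' x.1).-1 = z x.1 :> nat.
      by rewrite (set_coord_succ zxN) eqxx addn1.
      exact: set_coordK.
    by rewrite insub_bseqE ?es// size_rcons.
  + by apply/eqP => -[_ _ /(congr1 val)] /= e; move: jE; rewrite -e es size_rcons.
move=> _ _; have /split_at[A [x [y [B [es jA]]]]] : (0 < j < size s)%N.
  by rewrite lt0n j0 ltn_neqAle jE.
have us : uniq s by case/andP: ok => /uniq_unzip1.
have [okE dkE] := door_swap z A x y B.
have sE : swap_at j (bseqval s) = A ++ y :: x :: B by rewrite es jA swap_at_cat.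
have sz : (size (A ++ y :: x :: B) <= n)%N by move: sn; rewrite es !size_cat.
have pE : pivot ((z, s), j) = ((z, insub_bseq n (A ++ y :: x :: B)), j).
  by rewrite /pivot /= (negbTE j0) (negbTE jE) sE.
have s2 : size (A ++ y :: x :: B) = size s by rewrite es !size_cat.
rewrite pE /start /inner /outer /= insub_bseqE//.
move: dk ok; rewrite es {1}jA dkE -jA => -> /=; rewrite okE => -> /=.
split.
+ rewrite s2 (negbTE j0) (negbTE jE) /=.
  have -> : nilp (A ++ y :: x :: B) = false by case: (A).
  case: (A ++ _) => [|u w] //=; set r := rev _; by case: r.
+ rewrite /pivot /= (negbTE j0) insub_bseqE// s2 (negbTE jE).
  apply: room_eq => //; rewrite jA swap_at_cat insub_bseqE ?es//.
  by rewrite -es.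
+ apply/eqP => -[/(congr1 val)]/=; rewrite insub_bseqE// es => /eqP.
  rewrite eqseq_cat// eqxx /= !eqseq_cons => /and3P[_ /eqP yx _].
  move: us; rewrite es yx cat_uniq /= inE eqxx.
  by rewrite !andbF.
Qed.

Lemma head_perm_flip s x : uniq (unzip1 s) -> x.1 \in unzip1 s -> x \notin s -> flip x \in s.
Proof.
move=> us /mapP[[i b] ys /= e] xs; rewrite /flip e.
suff -> : ~~ x.2 = b by [].
move: xs ys; case: x e => i' b' /= ->.
by case: b; case: b' => // /negP.
Qed.

Lemma corner_grid z s A : in_grid (corner z s A).
Proof.
move=> i; rewrite ffunE; have := ltn_ord (z i).
by case: (_ \in s); case: (_ \in s); case: (_ \in unzip1 A) => /=; lia.
Qed.

Lemma corner_close z s A A' i : `|corner z s A i - corner z s A' i| <= 1.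
Proof.
rewrite !ffunE; case: (_ \in s); case: (_ \in s);
  case: (_ \in unzip1 A); case: (_ \in unzip1 A') => /=; lia.
Qed.

Lemma labels_consistent z s i j : label z s j <> flip (label z s i).
Proof. by apply: l_adj; try exact: corner_grid; move=> k; exact: corner_close. Qed.

(** A vertex in the hyperplane orthogonal to x belongs to the smaller orthant. *)
Lemma corner_cons z x t A : x.1 \notin unzip1 t -> z x.1 = 0%N :> nat ->
  x.1 \notin unzip1 A -> corner z (x :: t) A = corner z t A.
Proof.
move=> xt zx xA; apply/ffunP => i; rewrite !ffunE.
have [->|ix] := eqVneq i x.1; first by rewrite zx (negbTE xA) !mulr0.
by rewrite !inE -!pair_eqE /= (negbTE ix).
Qed.

Lemma inner_exit z x t : z x.1 = 0%N :> nat -> room_ok z (x :: t) ->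
  door_ok z (x :: t) 0 =
  perm_eq [seq label z t i | i <- iota 0 (size t).+1] (x :: t).
Proof.
move=> zx /andP[/= /andP[xt _] _]; rewrite /door_ok leq0n andTb.
have -> : rem 0%N (iota 0 (size (x :: t)).+1) = map (addn 1) (iota 0 (size t).+1).
  by rewrite -iotaDl.
rewrite -map_comp; congr (perm_eq _ _); apply/eq_map => i.
rewrite /= /label add1n /= corner_cons//.
by apply: contraNN xt => /mapP[y yt ->]; apply: map_f; exact: mem_drop yt.
Qed.

Lemma room_ok_cons z x t : room_ok z (x :: t) && (z x.1 == 0%N :> nat) =
  (x.1 \notin unzip1 t) && room_ok z t.
Proof.
rewrite /room_ok /=; case: (boolP (x.1 \in unzip1 t)) => //= xt.
case: (uniq _) => //=; apply/andP/forallP => [[/forallP zs /eqP zx] i|zs].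
  apply/implyP => it; have [->|ix] := eqVneq i x.1.
    by rewrite -val_eqE /= zx.
  by have := zs i; rewrite inE (negbTE ix) (negbTE it).
split; last by have := zs x.1; rewrite xt -val_eqE.
by apply/forallP => i; apply/implyP; rewrite inE negb_or => /andP[_ it]; have := zs i; rewrite it.
Qed.

Lemma size_room z s : room_ok z s -> (size s <= n)%N.
Proof.
move=> /andP[us _]; have := uniq_leq_size us (_ : {subset _ <= enum I}).
by rewrite size_map -cardE; apply => i _; rewrite mem_enum.
Qed.

(** The inner doors of the simplices of dimension k + 1 are the exits of the
    simplices of dimension k: forget the first direction. *)
Lemma card_inner : #|[set q in doors | inner q]| = #|exits|.
Proof.
pose down (q : room * 'I_n.+1) : room := (q.1.1, insub_bseq n (behead (bseqval q.1.2))).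
have behE (s : n.-bseq (I * bool)) : insub_bseq n (behead (bseqval s)) = behead (bseqval s) :> seq _.
  by rewrite insub_bseqE// size_behead (leq_trans (leq_pred _))// size_bseq.
have innerP q : q \in [set q in doors | inner q] -> exists x t,
   [/\ bseqval q.1.2 = x :: t, q.2 = 0%N :> nat, x.1 \notin unzip1 t, room_ok q.1.1 t &
     perm_eq [seq label q.1.1 t i | i <- iota 0 (size t).+1] (x :: t)].
  case: q => -[z s] j; rewrite !inE /inner /=; case es: (bseqval s) => [|x t]; first by rewrite andbF.
  move=> /andP[/andP[ok dk] /andP[/eqP j0 /eqP zx]]; exists x, t.
  have := room_ok_cons z x t; rewrite ok zx eqxx /= => /esym/andP[xt okt].
  by split=> //; rewrite -inner_exit// -j0.
have -> : exits = down @: [set q in doors | inner q].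
  apply/setP => -[z t]; apply/idP/imsetP => [|[q /innerP[x [u [qs _ xu ok W]]] ->]].
    rewrite inE /= => /andP[ok /existsP[x /andP[xt W]]].
    (* otherwise x and its opposite both label the room *)
    have xt' : x.1 \notin unzip1 t.
      apply/negP => xt'; have [us _] := andP ok.
      have fxt := head_perm_flip us xt' xt.
      have /mapP[i _ xi] : x \in [seq label z t i | i <- iota 0 (size t).+1].
        by rewrite (perm_mem W) mem_head.
      have /mapP[j _ xj] : flip x \in [seq label z t i | i <- iota 0 (size t).+1].
        by rewrite (perm_mem W) inE fxt orbT.
      by apply: (@labels_consistent z t i j); rewrite -xj -xi.
    have := room_ok_cons z x t; rewrite ok xt' => /andP[ok' /eqP zx].
    have sz := size_room ok'.
    exists ((z, insub_bseq n (x :: t)), ord0).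
      rewrite !inE /inner /= insub_bseqE// ok' inner_exit//= W /=.
      by rewrite zx.
    by congr pair; apply: val_inj; rewrite /down /= behE insub_bseqE.
  rewrite inE /= behE qs /= ok; apply/existsP; exists x; rewrite W andbT.
  by apply: contraNN xu => xu; apply: map_f.
rewrite card_in_imset// => -[[z1 s1] j1] [[z2 s2] j2] /innerP[x1 [t1 [/= e1 j10 _ _ W1]]]
  /innerP[x2 [t2 [/= e2 j20 _ _ W2]]] [] ez /(congr1 val).
rewrite /= !behE /= e1 e2 /= => et; apply: room_eq => //; last by rewrite j10 j20.
rewrite e1 e2 et; congr cons; subst z2 t2.
by apply: (@perm_cons_inj _ _ _ t1); apply: perm_trans W2; rewrite perm_sym.
Qed.

Lemma flipK : involutive flip.
Proof. by case=> i b; rewrite /flip /= negbK. Qed.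

Lemma unzip1_flip s : unzip1 (map flip s) = unzip1 s.
Proof. by rewrite /unzip1 -map_comp; apply: eq_map => -[]. Qed.

Lemma corner_flip z s A : corner z (map flip s) A = [ffun i => - corner z s A i].
Proof.
apply/ffunP => i; rewrite !ffunE -mulNr opprB.
have memf b : ((i, b) \in map flip s) = ((i, ~~ b) \in s).
  by rewrite -(mem_map (can_inj flipK) s (i, ~~ b)) /flip /= negbK.
by rewrite !memf.
Qed.

(** The labelling is antipodal on the boundary, so the outer doors come in
    opposite pairs. *)
Lemma even_outer : ~~ odd #|[set q in doors | outer q]|.
Proof.
pose anti (q : room * 'I_n.+1) : room * 'I_n.+1 :=
  ((q.1.1, insub_bseq n (map flip (bseqval q.1.2))), q.2).
have antE (s : n.-bseq (I * bool)) : insub_bseq n (map flip (bseqval s)) = map flip (bseqval s) :> seq _.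
  by rewrite insub_bseqE// size_map size_bseq.
apply: (@odd_card_involution _ _ anti) => -[[z s] j].
rewrite !inE /outer /= antE -map_rev size_map.
case es: (rev s) => [|x t]; first by rewrite andbF.
move=> /andP[/andP[ok dk] /andP[/eqP js /eqP zx]]; rewrite /= js eqxx zx eqxx /= !andbT.
split.
- apply/andP; split; first by move: ok; rewrite /room_ok unzip1_flip.
  move: dk; rewrite js /door_ok size_map !leqnn !andTb => /(perm_map flip).
  rewrite -map_comp; apply/perm_trans; rewrite perm_sym.
  have -> // : [seq (flip \o label z s) i | i <- rem (size s) (iota 0 (size s).+1)] =
     [seq label z (map flip s) i | i <- rem (size s) (iota 0 (size s).+1)].
  apply/eq_in_map => i; rewrite (perm_mem (perm_iota_last _)) mem_iota /= => iN.
  rewrite /label -map_drop corner_flip.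
  have -> : corner z s (map flip (drop i s)) = corner z s (drop i s).
    by apply: corner_eq => // k; rewrite unzip1_flip.
  rewrite l_anti//; first exact: corner_grid.
  have es' : val s = rcons (rev t) x by rewrite /= -[bseqval s]revK es rev_cons.
  have xs : x \in val s by rewrite es' mem_rcons mem_head.
  have [us _] := andP ok.
  have nxs : flip x \notin val s.
    apply/negP => fxs.
    have := us; rewrite es' /unzip1 map_rcons rcons_uniq => /andP[/negP nt _]; apply: nt.
    move: fxs; rewrite es' mem_rcons inE => /orP[/eqP|/(map_f fst)]; last by [].
    by case: (x) => k [] [].
  exists x.1; rewrite ffunE zx.
  have -> : x.1 \in unzip1 (drop i s).
    apply: map_f; rewrite es' drop_rcons ?mem_rcons ?mem_head//.
    by move: iN; rewrite es' size_rcons ltnS.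
  move: xs nxs; case: (x) => k [] /= -> /negbTE -> /=; lia.
- by apply: room_eq => //; rewrite /= !antE -map_comp map_id_in// => y _ /=; rewrite flipK.
- apply/eqP => -[/(congr1 val)]/=; rewrite antE => /(congr1 rev).
  by rewrite -map_rev es /= => -[]; case: (x) => k [].
Qed.

Lemma card_start : #|[set q in doors | start q]| = 1%N.
Proof.
apply/eqP/cards1P; exists (([ffun=> ord0], insub_bseq n [::]), ord0).
apply/setP => -[[z s] j]; rewrite !inE /start /=; apply/idP/eqP => [|[-> -> ->]].
  move=> /andP[/andP[/andP[_ /forallP z0] /andP[j0 _]] /nilP s0].
  move: z0 j0; rewrite s0 leqn0 => z0 /eqP j0.
  apply: room_eq => //; last by rewrite insub_bseqE ?s0.
  by apply/ffunP => i; rewrite ffunE; have := z0 i => /eqP.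
rewrite insub_bseqE// andbT; apply/andP; split=> //.
by apply/forallP => i; rewrite ffunE.
Qed.

(** Counted by rooms, the parity of the doors is that of the exits, hence of the
    inner doors.  Counted by facets, [pivot] pairs the doors which are neither
    inner nor outer; the outer ones are even in number, and the door of the
    origin is left over. *)
Lemma inconsistent_labelling : False.
Proof.
have := odd_doors.
have -> : #|doors| = (#|[set q in doors | start q]| + (#|[set q in doors | inner q]|
     + (#|[set q in doors | outer q]| + #|inside|)))%N.
  rewrite -(cardsID [set q | start q] doors); congr (_ + _)%N.
    by apply: eq_card => q; rewrite !inE.
  rewrite -(cardsID [set q | inner q] (_ :\: _)); congr (_ + _)%N.
    apply: eq_card => -[[z s] j]; rewrite !inE /inner /start /=.
    by case: (bseqval s) => [|x t]; rewrite ?andbF//= andbT.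
  rewrite -(cardsID [set q | outer q] (_ :\: _)); congr (_ + _)%N.
    apply: eq_card => -[[z s] j]; rewrite !inE /inner /start /outer /=.
    case es: (bseqval s) => [|x t]; first by rewrite /= !andbF.
    case: (rev _) => [|y u]; first by rewrite !andbF.
    rewrite /=; case: eqVneq => [j0|_]; last by rewrite /= ?andbT.
    by rewrite j0 /= !andbF.
  apply: eq_card => q; rewrite !inE; by case: (start q); case: (inner q); case: (outer q); rewrite /= ?andbT ?andbF.
rewrite card_start card_inner !oddD (negbTE even_outer).
rewrite (negbTE (@odd_card_involution _ _ pivot _)).
  by case: (odd #|exits|).
by move=> q /pivotP[].
Qed.

End Tucker.

Theorem tucker (I : finType) (N : nat) (l : {ffun I -> int} -> I * bool) :
  (forall v : {ffun I -> int}, in_grid N v -> (exists i, `|v i|%R = N.+1) ->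
    l [ffun i => - v i]%R = flip (l v)) ->
  exists v w : {ffun I -> int}, [/\ in_grid N v, in_grid N w,
    (forall i, `|v i - w i| <= 1)%R & l w = flip (l v)].
Proof.
move=> anti; apply: contrapT => noedge; apply: (inconsistent_labelling _ anti) => v w vN wN vw lvw.
by apply: noedge; exists v, w.
Qed.

Local Open Scope classical_set_scope.
Local Open Scope ring_scope.

(** * Limits along ultrafilters and the Borsuk-Ulam theorem *)

(** Limits along one ultrafilter on nat replace all extractions of subsequences:
    every coordinate of a bounded sequence of vectors converges at once. *)
Lemma ultra_bounded_cvg (R : realType) (F : set_system nat) (X : nat -> R) (B : R) :
  UltraFilter F -> (\forall n \near F, `|X n| <= B) ->
  exists x : R, `|x| <= B /\ X n @[n --> F] --> x.
Proof.
move=> FU XB.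
have IF : UltraFilter (X n @[n --> F]).
  split; first exact: fmap_proper_filter.
  move=> G GG sFG; rewrite eqEsubset; split=> // A GA.
  have [//|FnA] := in_ultra_setVsetC (X @^-1` A) FU.
  have GnA : G (~` A) by apply: sFG.
  by have /filter_ex[? []] : G (A `&` ~` A) by exact: filterI.
move: (@segment_compact R (- B) B); rewrite compact_ultra.
move=> /(_ (X n @[n --> F]) IF) [|x [xB Xx]].
  by apply: filterS XB => n; rewrite /= in_itv /= ler_norml.
by exists x; split => //; move: xB; rewrite /= in_itv /= ler_norml.
Qed.

(** Continuity for coordinatewise convergence, phrased so that it applies to
    finitely and to infinitely many coordinates and is stable by iteration. *)
Definition pointwise_continuous (R : realType) (S S' : Type)
    (G : (S -> R) -> S' -> R) :=
  forall (F : set_system nat), ProperFilter F ->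
  forall (X : nat -> S -> R) (x : S -> R),
  (forall i, X n i @[n --> F] --> x i) ->
  forall j, G (X n) j @[n --> F] --> G x j.

Lemma cvg_sum_seq (R : realType) (I : Type) (r : seq I) (F : set_system nat) (X : nat -> I -> R) (x : I -> R) :
  ProperFilter F -> (forall i, X n i @[n --> F] --> x i) ->
  \sum_(i <- r) X n i @[n --> F] --> \sum_(i <- r) x i.
Proof.
move=> FF Xx; elim: r => [|i r IH].
  by rewrite big_nil; under eq_fun do rewrite big_nil; exact: cvg_cst.
by rewrite big_cons; under eq_fun do rewrite big_cons; apply: cvgD.
Qed.

Lemma cvg0_le_harmonic (R : realType) (F : set_system nat) (X : nat -> R) :
  ProperFilter F -> \oo `<=` F -> (forall n, `|X n| <= n.+1%:R^-1) ->
  X n @[n --> F] --> (0 : R).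
Proof.
move=> FF sF Xh; apply/cvgr0Pnorm_lt => e e0.
have harm0 : (@harmonic R) n @[n --> F] --> (0 : R).
  by apply: (cvg_trans _ (@cvg_harmonic R)) => A; exact: sF.
have hN : \forall n \near F, `|(@harmonic R) n| < e by exact: cvgr0_norm_lt.
apply: filterS hN => n; rewrite ger0_norm ?harmonic_ge0//.
exact: le_lt_trans.
Qed.

Lemma cvg_bigmax_norm (R : realType) (I : finType) (U : set_system nat) (X : nat -> I -> R) (x : I -> R) :
  ProperFilter U -> (forall i, X n i @[n --> U] --> x i) ->
  \big[Num.max/0]_i `|X n i| @[n --> U] --> \big[Num.max/0]_i `|x i|.
Proof.
move=> UU Xx; elim: (index_enum I) => [|i s IH].
  by rewrite big_nil; under eq_fun do rewrite big_nil; exact: cvg_cst.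
rewrite big_cons maxr_absE; under eq_fun do rewrite big_cons maxr_absE.
have Xi : `|X n i| @[n --> U] --> `|x i| by exact: cvg_norm.
by apply: cvgMl; apply: cvgD; [exact: cvgD|apply: cvg_norm; exact: cvgB].
Qed.

Section BorsukUlam.
Variables (R : realType) (I : finType) (G : (I -> R) -> I -> R).
Hypothesis G_odd : forall x, (forall i, `|x i| <= 1) -> (exists i, `|x i| = 1) ->
  forall j, G (fun i => - x i) j = - G x j.

(** A grid point is labelled by the coordinate where |G| is largest, with the
    sign of G there.  At neighbours with opposite labels this coordinate of G
    changes sign, so that G is no larger than its variation between them. *)
Lemma approximate_zero (N : nat) : exists x y : I -> R,
  [/\ forall i, `|x i| <= 1, forall i, `|x i - y i| <= N.+1%:R^-1 &
      forall j, `|G x j| <= \sum_i `|G x i - G y i| ].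
Proof.
have [[x [x1 Gx]]|nozero] := pselect (exists x, (forall i, `|x i| <= 1) /\ forall j, G x j = 0).
  exists x, x; split=> // [i|j]; first by rewrite subrr normr0.
  by rewrite Gx normr0; apply: sumr_ge0.
have [i0 _|I0] := pickP I; last first.
  by exfalso; apply: nozero; exists (fun=> 0); split=> i; have := I0 i.
pose pt (v : {ffun I -> int}) (i : I) : R := (v i)%:~R / N.+1%:R.
pose l (v : {ffun I -> int}) : I * bool :=
  let i := [arg max_(i > i0) `|G (pt v) i|]%O in (i, 0 < G (pt v) i).
have N0 : 0 < N.+1%:R :> R by [].
have pt1 v : in_grid N v -> forall i, `|pt v i| <= 1.
  move=> vN i; rewrite normrM normfV (ger0_norm (ltW N0)) ler_pdivrMr// mul1r.
  by rewrite -intr_norm (_ : N.+1%:R = (N.+1%:Z)%:~R)// ler_int; exact: vN.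
have argP v j : `|G (pt v) j| <= `|G (pt v) (l v).1|.
  by rewrite /l /=; case: arg_maxP => //= i _; apply.
have G0 v : in_grid N v -> G (pt v) (l v).1 != 0.
  move=> vN; apply/eqP => G0; apply: nozero; exists (pt v); split; first exact: pt1.
  by move=> j; apply/normr0_eq0/eqP; rewrite eq_le normr_ge0 -(normr0 R) -G0 argP.
have [v vN [i vi]|v [w [vN wN vw lvw]]] := @tucker I N l.
  have ptN : pt [ffun i => - v i] = fun i => - pt v i.
    by apply/funext => j; rewrite /pt ffunE mulrNz mulNr.
  have GN j : G (pt [ffun i => - v i]) j = - G (pt v) j.
    rewrite ptN G_odd//; first exact: pt1.
    exists i; rewrite normrM normfV (ger0_norm (ltW N0)) -intr_norm vi.
    by rewrite divff// gt_eqF.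
  rewrite /flip /l.
  have -> : (fun i => `|G (pt [ffun i => - v i]) i|) = (fun i => `|G (pt v) i|).
    by apply/funext => j; rewrite GN normrN.
  congr pair; rewrite GN oppr_gt0 -leNgt le_eqVlt.
  by have /negbTE-> := G0 v vN.
exists (pt v), (pt w); split; first exact: pt1.
  move=> i; rewrite /pt -mulrBl -intrB normrM normfV (ger0_norm (ltW N0)).
  rewrite ler_piMl ?invr_ge0// -intr_norm.
  by have := vw i; rewrite -(ler_int R).
move=> j; apply: le_trans (argP v j) _.
have li : (l w).1 = (l v).1 by rewrite lvw.
have lb : (0 < G (pt w) (l v).1) = ~~ (0 < G (pt v) (l v).1).
  by rewrite -{1}li; have := congr1 snd lvw.
rewrite (bigD1 (l v).1)//= ler_wpDr ?sumr_ge0//.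
have [v0|v0] := ltrP 0 (G (pt v) (l v).1).
  move: lb; rewrite v0 /= => /negbT; rewrite -leNgt => w0.
  by rewrite !ger0_norm ?subr_ge0 ?(ltW v0) ?(le_trans w0) ?(ltW v0)// lerDl oppr_ge0.
have w0 : 0 < G (pt w) (l v).1 by rewrite lb -leNgt.
by rewrite !ler0_norm ?subr_le0 ?(le_trans v0) ?(ltW w0)// opprB lerDr ltW.
Qed.

Theorem borsuk_ulam : pointwise_continuous G ->
  exists x, (forall i, `|x i| <= 1) /\ forall j, G x j = 0.
Proof.
move=> Gc; have /choice[X] := approximate_zero; move=> /choice[Y XY].
have [F [FU sF]] := @ultraFilterLemma nat \oo _.
have /choice[x xP] (i : I) : exists x : R, `|x| <= 1 /\ X n i @[n --> F] --> x.
  by apply: ultra_bounded_cvg; apply: nearW => n; have [] := XY n.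
have Yx i : Y n i @[n --> F] --> x i.
  have -> : (fun n => Y n i) = (fun n => X n i - (X n i - Y n i)).
    by apply/funext => n; ring.
  rewrite -[x i]subr0; apply: cvgB; first by have [] := xP i.
  by apply: cvg0_le_harmonic => // n; have [] := XY n.
exists x; split=> [i|j]; first by have [] := xP i.
have Xx i : X n i @[n --> F] --> x i by have [] := xP i.
apply/eqP; rewrite -normr_eq0 eq_le normr_ge0 andbT.
have lim1 : `|G (X n) j| @[n --> F] --> `|G x j| by apply: cvg_norm; exact: Gc.
have lim2 : \sum_i `|G (X n) i - G (Y n) i| @[n --> F] --> \sum_(i : I) `|G x i - G x i|.
  apply: cvg_sum_seq => i; apply: cvg_norm; apply: cvgB; exact: Gc.
rewrite [leRHS](_ : 0 = \sum_(i : I) `|G x i - G x i|); last first.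
  by rewrite big1// => i _; rewrite subrr normr0.
apply: (@ler_cvg_to _ _ _ _ _ _ _ _ lim1 lim2).
by apply: nearW => n; have [_ _] := XY n; apply.
Qed.

End BorsukUlam.

(** * The power function and the primitive of the nonlinearity *)
Section Powers.
Variables (R : realType) (p : R).
Hypothesis p1 : 1 < p.
Let p0 : 0 < p. Proof. exact: lt_trans p1. Qed.

Lemma normr_powR_continuous (q : R) : 0 < q -> continuous (fun t : R => `|t| `^ q).
Proof.
move=> q0 t; have [->|t0] := eqVneq t 0.
  rewrite /continuous_at normr0 powR0 ?gt_eqF//; apply/cvgr0Pnorm_lt => e e0.
  have d0 : 0 < e `^ q^-1 by rewrite powR_gt0.
  exists (e `^ q^-1) => // x /=; rewrite sub0r normrN => xe.
  rewrite ger0_norm ?powR_ge0//.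
  have -> : e = (e `^ q^-1) `^ q by rewrite -powRrM mulVf ?gt_eqF// powRr1// ltW.
  by rewrite gt0_ltr_powR// nnegrE ?normr_ge0// ltW.
have nt : 0 < `|t| by rewrite normr_gt0.
apply: (@continuous_comp _ _ _ (fun t : R => `|t|) (fun s => s `^ q)).
  exact: norm_continuous.
apply/differentiable_continuous/derivable1_diffP.
exact: (@ex_derive _ _ _ _ _ _ _ (is_derive1_powR q nt)).
Qed.

Lemma normr_phi (t : R) : `|phi p t| = `|t| `^ (p - 1).
Proof.
rewrite /phi normrM ger0_norm ?powR_ge0// mulrC.
have -> : p - 2 = (p - 1) - 1 by ring.
by rewrite mulr_powRB1// subr_gt0.
Qed.

Lemma phi0 : phi p 0 = 0. Proof. by rewrite /phi mulr0. Qed.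

Lemma phiN (t : R) : phi p (- t) = - phi p t.
Proof. by rewrite /phi normrN mulrN. Qed.

Lemma phi_sg (t : R) : phi p t = Num.sg t * `|t| `^ (p - 1).
Proof.
by rewrite -normr_phi /phi normrM (ger0_norm (powR_ge0 _ _)) mulrCA -numEsg.
Qed.

Lemma phi_mul (t : R) : phi p t * t = `|t| `^ p.
Proof.
by rewrite phi_sg mulrAC -normrEsg mulr_powRB1.
Qed.

Lemma phi_continuous : continuous (phi p).
Proof.
move=> t; have q0 : 0 < p - 1 by rewrite subr_gt0.
have [->|t0] := eqVneq t 0.
  rewrite /continuous_at phi0; apply/cvgr0Pnorm_lt => e e0.
  have := @normr_powR_continuous _ q0 0.
  rewrite /continuous_at normr0 powR0 ?gt_eqF// => /cvgr0Pnorm_lt/(_ e e0).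
  by apply: filterS => x; rewrite normr_phi ger0_norm ?powR_ge0.
rewrite /phi; apply: cvgM; last exact: cvg_id.
have nt : 0 < `|t| by rewrite normr_gt0.
apply: (@continuous_comp _ _ _ (fun t : R => `|t|) (fun s => s `^ (p - 2))).
  exact: norm_continuous.
apply/differentiable_continuous/derivable1_diffP.
exact: (@ex_derive _ _ _ _ _ _ _ (is_derive1_powR (p - 2) nt)).
Qed.

Lemma phi_mul_le (x y : R) : `|y| <= `|x| -> phi p x * y <= `|x| `^ p.
Proof.
move=> yx; apply: le_trans (ler_norm _) _.
rewrite normrM normr_phi -(@mulr_powRB1 _ `|x| p)// [leRHS]mulrC.
by rewrite ler_wpM2l ?powR_ge0.
Qed.

(** Young's inequality with the exponents p / (p - 1) and p. *)
Lemma phi_young (t s : R) : phi p t * s <= `|t| `^ p * (1 - p^-1) + `|s| `^ p / p.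
Proof.
have q0 : 0 < p - 1 by rewrite subr_gt0.
have := @conjugate_powR R (`|t| `^ (p - 1)) `|s| (p / (p - 1)) p.
rewrite powR_ge0 normr_ge0 divr_gt0// p0 -powRrM => /(_ isT isT isT isT).
have -> : (p - 1) * (p / (p - 1)) = p by field; rewrite gt_eqF.
have -> : (p / (p - 1))^-1 = 1 - p^-1 by field; rewrite !gt_eqF.
rewrite subrK => /(_ erefl); apply: le_trans.
by rewrite -normr_phi -normrM ler_norm.
Qed.

(** |t|^p / p is convex and lies above its tangents, of slope phi p. *)
Lemma phi_convex (t h : R) :
  `|t| `^ p / p + phi p t * h <= `|t + h| `^ p / p.
Proof.
have := phi_young t (t + h); rewrite mulrDr phi_mul.
by rewrite mulrBr mulr1; lra.
Qed.

Lemma powR_normD_le (s t : R) : `|s - t| `^ p <= 2 `^ p * (`|s| `^ p + `|t| `^ p).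
Proof.
have pge0 : 0 <= p by exact: ltW.
have m0 : 0 <= Num.max `|s| `|t| by rewrite le_max normr_ge0.
apply: (@le_trans _ _ ((2 * Num.max `|s| `|t|) `^ p)).
  apply: ge0_ler_powR => //; rewrite ?nnegrE ?normr_ge0 ?mulr_ge0//.
  apply: le_trans (ler_normB _ _) _; rewrite mulr_natl mulr2n lerD// le_max lexx ?orbT//.
rewrite powRM// ler_pM2l ?powR_gt0//.
by case: (leP `|s| `|t|) => _; rewrite ?lerDl ?lerDr powR_ge0.
Qed.

End Powers.

Section Primitive.
Variables (R : realType) (f : int -> R -> R).
Hypothesis hf : forall k, continuous (f k).
Local Notation mu := (@lebesgue_measure R).

Lemma integrable_seg k (x y : R) : mu.-integrable `[x, y] (EFin \o f k).
Proof.
apply: continuous_compact_integrable; first exact: segment_compact.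
exact/continuous_subspaceT/hf.
Qed.

(** Moving the base point of the integral far to the left puts both signs of x
    under the same formula. *)
Lemma primFE k (a x : R) : a <= 0 -> a <= x ->
  primF f k x = \int[mu]_(t in `[a, x]) f k t - \int[mu]_(t in `[a, 0]) f k t.
Proof.
move=> a0 ax; rewrite /primF /Defs.integral0; case: (leP 0 x) => x0.
  rewrite Rintegral_itvB ?bnd_simp//; last exact: integrable_seg.
  rewrite Rintegral_itv_obnd_cbnd//.
  by apply: integrableS (integrable_seg k 0 x) => //; exact: subset_itv_oc_cc.
rewrite -opprB; congr (- _).
rewrite (Rintegral_itvB (integrable_seg k a 0)) ?bnd_simp//; last exact: ltW.
rewrite Rintegral_itv_obnd_cbnd//.
by apply: integrableS (integrable_seg k x 0) => //; exact: subset_itv_oc_cc.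
Qed.

Lemma primF_derive k (t : R) : is_derive t 1 (primF f k) (f k t).
Proof.
pose a := - `|t| - 1.
have a0 : a <= 0 by rewrite /a; have := normr_ge0 t; lra.
have at_ : a < t by rewrite /a; have := lerNnormlW (lexx `|t|); lra.
have [dG DG] := @continuous_FTC1_closed R (f k) a t (t + 1) (ltr_pwDr ltr01 (lexx _))
  (integrable_seg k a (t + 1)) at_ (@hf k t).
pose G x := \int[mu]_(t in `[a, x]) f k t - \int[mu]_(t in `[a, 0]) f k t.
have GD : is_derive t 1 G (f k t).
  rewrite -[f k t]subr0; apply: is_deriveB.
  by rewrite -DG derive1E; exact: derivableP dG.
apply: (@near_eq_is_derive _ _ _ G) => //.
near=> x; rewrite (@primFE k a)//; apply: ltW.
near: x; exact: lt_nbhsr.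
Unshelve. all: by end_near. Qed.

Lemma primF0 k : primF f k 0 = 0.
Proof. by rewrite (@primFE k 0)// subrr. Qed.

Lemma primF_mvt k (t h : R) : exists2 th, 0 <= th <= 1 &
  primF f k (t + h) - primF f k t = f k (t + th * h) * h.
Proof.
have cF : continuous (primF f k).
  move=> x; apply/differentiable_continuous/derivable1_diffP.
  by have := primF_derive k x; case.
have [->|h0] := eqVneq h 0.
  by exists 0; rewrite ?lexx ?ler01// addr0 subrr mulr0.
have [hp|hn] := ltP 0 h.
  have [|x _||c] := @MVT_segment R (primF f k) (f k) t (t + h); first by rewrite lerDl ltW.
  - exact: primF_derive.
  - exact/continuous_subspaceT.
  rewrite in_itv /= => /andP[tc ch] e; exists ((c - t) / h).
    by rewrite divr_ge0 ?subr_ge0 ?(ltW hp)//= ler_pdivrMr// mul1r; lra.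
  by rewrite e divfK// subrKC; ring.
have {h0} hn : h < 0 by rewrite lt_neqAle h0.
have [|x _||c] := @MVT_segment R (primF f k) (f k) (t + h) t; first by lra.
- exact: primF_derive.
- exact/continuous_subspaceT.
rewrite in_itv /= => /andP[tc ch] e; exists ((c - t) / h).
  rewrite ler_ndivrMr// mul1r ler_ndivlMr// mul0r; lra.
by rewrite -[LHS]opprB e divfK ?lt_eqF// subrKC; ring.
Qed.

End Primitive.

(** * Sums over symmetric windows *)
Fixpoint window (n : nat) : seq int :=
  if n is m.+1 then n%:Z :: - n%:Z :: window m else [:: 0].

Lemma mem_window n (k : int) : (k \in window n) = (`|k| <= n%:Z).
Proof.
elim: n => [|n IH]; first by rewrite inE; lia.
by rewrite /= !inE IH; lia.
Qed.

Lemma uniq_window n : uniq (window n).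
Proof.
elim: n => [//|n IH]; rewrite /= IH !inE !mem_window andbT; lia.
Qed.

Section WindowSums.
Variable R : realType.
Implicit Types (F H : int -> R).

Lemma sum_windowS n F : \sum_(k <- window n.+1) F k =
  F n.+1%:Z + F (- n.+1%:Z) + \sum_(k <- window n) F k.
Proof. by rewrite /= !big_cons addrA. Qed.

Lemma sum_window_shift n F : \sum_(k <- window n) F (k - 1) =
  \sum_(k <- window n) F k + F (- n.+1%:Z) - F n%:Z.
Proof.
elim: n => [|n IH]; first by rewrite /= !big_seq1; rewrite sub0r; ring.
rewrite !sum_windowS IH.
have -> : n.+1%:Z - 1 = n%:Z by lia.
have -> : - n.+1%:Z - 1 = - n.+2%:Z by lia.
ring.
Qed.

(** Summation by parts; the two boundary terms vanish for v supported in a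
    smaller window. *)
Lemma sum_window_by_parts n (c v : int -> R) :
  \sum_(k <- window n) c k * (v k - v (k - 1)) =
  \sum_(k <- window n) (c k - c (k + 1)) * v k
    + c n.+1%:Z * v n%:Z - c (- n%:Z) * v (- n.+1%:Z).
Proof.
have := sum_window_shift n (fun k => c (k + 1) * v k).
under eq_bigr do rewrite subrK.
have -> : n%:Z + 1 = n.+1%:Z by lia.
have -> : - n.+1%:Z + 1 = - n%:Z by lia.
move=> e; under eq_bigr do rewrite mulrBr.
under [in RHS]eq_bigr do rewrite mulrBl.
by rewrite !sumrB e; ring.
Qed.

Lemma le_sum_window n F H : (forall k, `|k| <= n%:Z -> F k <= H k) ->
  \sum_(k <- window n) F k <= \sum_(k <- window n) H k.
Proof.
move=> FH; rewrite big_seq [leRHS]big_seq; apply: ler_sum => k.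
by rewrite mem_window; exact: FH.
Qed.

Lemma eq_sum_window n F H : (forall k, `|k| <= n%:Z -> F k = H k) ->
  \sum_(k <- window n) F k = \sum_(k <- window n) H k.
Proof.
by move=> FH; apply: eq_big_seq => k; rewrite mem_window; exact: FH.
Qed.

Lemma sum_window_mono n m F : (forall k, 0 <= F k) -> (n <= m)%N ->
  \sum_(k <- window n) F k <= \sum_(k <- window m) F k.
Proof.
move=> F0; elim: m => [|m IH]; first by rewrite leqn0 => /eqP->.
rewrite leq_eqVlt => /predU1P[->//|nm]; rewrite sum_windowS.
by rewrite ler_wpDl ?addr_ge0// IH.
Qed.

Lemma sum_window_term n F (k : int) : (forall k, 0 <= F k) -> `|k| <= n%:Z ->
  F k <= \sum_(j <- window n) F j.
Proof.
move=> F0 kn; rewrite (bigD1_seq k) ?uniq_window ?mem_window//=.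
by rewrite lerDl sumr_ge0.
Qed.

Lemma sum_window_tail m n F H : (forall k, 0 <= H k) ->
  (forall k, m%:Z < `|k| -> F k <= H k) -> (m <= n)%N ->
  \sum_(k <- window n) F k <= \sum_(k <- window m) F k + \sum_(k <- window n) H k.
Proof.
move=> H0 FH; elim: n => [|n IH].
  by rewrite leqn0 => /eqP->; rewrite lerDl sumr_ge0.
rewrite leq_eqVlt => /predU1P[->|mn]; first by rewrite lerDl sumr_ge0.
rewrite !sum_windowS; have := IH mn.
have A : F n.+1%:Z <= H n.+1%:Z by apply: FH; lia.
have B : F (- n.+1%:Z) <= H (- n.+1%:Z) by apply: FH; lia.
lra.
Qed.

Lemma sum_window_widen n m F : (forall k, n%:Z < `|k| -> F k = 0) -> (n <= m)%N ->
  \sum_(k <- window m) F k = \sum_(k <- window n) F k.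
Proof.
move=> F0; elim: m => [|m IH]; first by rewrite leqn0 => /eqP->.
rewrite leq_eqVlt => /predU1P[->//|nm]; rewrite sum_windowS IH// !F0 ?addr0 ?add0r//; lia.
Qed.

Lemma sum_window_cst n (c : R) : \sum_(k <- window n) c = c *+ n.*2.+1.
Proof.
elim: n => [|n IH]; first by rewrite /= big_seq1.
by rewrite (sum_windowS n (fun=> c)) IH doubleS !mulrS addrA.
Qed.

End WindowSums.

Definition supported (R : realType) (n : nat) (u : int -> R) :=
  forall k, n%:Z < `|k| -> u k = 0.

(** The values that occur in the boundary terms of a summation by parts over
    [window n.+1]. *)
Lemma supported_edge (R : realType) n (u : int -> R) : supported n u ->
  [/\ u n.+1%:Z = 0, u (- n.+1%:Z) = 0 & u (- n.+2%:Z) = 0].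
Proof. by move=> un; split; apply: un; lia. Qed.

Lemma uniform_continuity_segment (R : realType) (g : R -> R) (B om : R) :
  continuous g -> 0 < om -> exists2 r : R, 0 < r &
  forall s h, `|s| <= B -> `|h| <= r -> `|g (s + h) - g s| <= om.
Proof.
move=> gc om0; apply: contrapT => nr.
have /choice[sh shP] (m : nat) : exists sh : R * R, [/\ `|sh.1| <= B,
    `|sh.2| <= m.+1%:R^-1 & om < `|g (sh.1 + sh.2) - g sh.1| ].
  apply: contrapT => nsh; apply: nr; exists m.+1%:R^-1; first by rewrite invr_gt0.
  move=> s h sB hm; rewrite leNgt; apply/negP => gs; apply: nsh.
  by exists (s, h).
have [U [UU sU]] := @ultraFilterLemma nat \oo _.
have [s [_ ss]] : exists s : R, `|s| <= B /\ (sh n).1 @[n --> U] --> s.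
  by apply: ultra_bounded_cvg; apply: nearW => n; have [] := shP n.
have h0 : (sh n).2 @[n --> U] --> (0 : R).
  by apply: cvg0_le_harmonic => // n; have [] := shP n.
have lim : `|g ((sh n).1 + (sh n).2) - g (sh n).1| @[n --> U] --> `|g (s + 0) - g s|.
  apply: cvg_norm; apply: cvgB; apply: continuous_cvg => //; try exact: gc.
  exact: cvgD.
have : om <= `|g (s + 0) - g s|.
  by apply: (cvgr_to_ge lim); apply: nearW => n; have [_ _ /ltW] := shP n.
by rewrite addr0 subrr normr0 leNgt om0.
Qed.

Lemma norm_natz (m : nat) : `|m%:Z| = m%:Z. Proof. by []. Qed.

Lemma lt_succz (K : nat) (k : int) : K.+1%:Z < `|k| -> K%:Z < `|k|.
Proof. lia. Qed.

Lemma le_succz (n : nat) (k : int) : `|k| <= n%:Z -> `|k| <= n.+1%:Z.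
Proof. lia. Qed.

Section WindowEsum.
Variables (R : realType) (g : int -> R).
Hypothesis g0 : forall k, 0 <= g k.

Lemma esum_le_window (B : R) : (forall m, \sum_(k <- window m) g k <= B) ->
  (\esum_(k in [set: int]) (g k)%:E <= B%:E)%E.
Proof.
move=> gB; apply: ge_ereal_sup => _ [A [finA _] <-].
have [X uX ->] : exists2 X : seq int, uniq X & A = [set` X].
  have /finite_seqP[r ->] := finA; exists (undup r); first exact: undup_uniq.
  by apply/seteqP; split=> k /=; rewrite mem_undup.
rewrite -fsbig_seq// sumEFin lee_fin.
pose m := \max_(k <- X) `|k|%N.
apply: le_trans (gB m).
have -> : \sum_(k <- X) g k = \sum_(k <- window m | k \in X) g k.
  rewrite -[RHS]big_filter; apply: perm_big; apply: uniq_perm.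
  - exact: uX.
  - by rewrite filter_uniq// uniq_window.
  - move=> k; rewrite mem_filter mem_window; case: (boolP (k \in X)) => //= kX.
    apply/esym; have := @leq_bigmax_seq _ X predT (fun k : int => `|k|%N) k kX isT.
    by rewrite -/m; lia.
by rewrite [leRHS](bigID (fun k => k \in X)) /= lerDl sumr_ge0.
Qed.

Lemma window_le_esum m : ((\sum_(k <- window m) g k)%:E <= \esum_(k in [set: int]) (g k)%:E)%E.
Proof.
apply: ereal_sup_ubound; exists [set` window m]; first by split => //; exact: finite_seq.
by rewrite -fsbig_seq ?uniq_window// sumEFin.
Qed.

End WindowEsum.

Section SoftThreshold.
Variable R : realType.
Implicit Types e t s : R.

(** Soft thresholding.  It turns a sequence tending to 0 into a finitely supported
    one without increasing any difference, even where a is unbounded; cutting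
    the sequence off sharply would not do this. *)
Definition soft e t : R := if e < t then t - e else if t < - e then t + e else 0.

Lemma soft_small e t : `|t| <= e -> soft e t = 0.
Proof.
by rewrite ler_norml /soft => /andP[h1 h2]; rewrite ltNge h2 /= ltNge h1.
Qed.

Lemma soft_lipschitz e t s : 0 < e -> `|soft e t - soft e s| <= `|t - s|.
Proof.
move=> e0; rewrite ler_norml; apply/andP.
have A : t - s <= `|t - s| by exact: ler_norm.
have B : - (t - s) <= `|t - s| by rewrite -normrN ler_norm.
rewrite /soft; do 4?[case: ltP => ?]; split; lra.
Qed.

Lemma soft_norm e t : 0 < e -> `|soft e t| <= `|t|.
Proof.
move=> e0; have := soft_lipschitz t 0 e0.
by rewrite (@soft_small e 0) ?normr0 ?(ltW e0)// !subr0.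
Qed.

Lemma soft_near e t : 0 < e -> `|soft e t - t| <= e.
Proof.
move=> e0; rewrite /soft ler_norml.
by case: ltP => ?; [|case: ltP => ?]; apply/andP; split; lra.
Qed.

Lemma soft_sign e t y : 0 < e -> 0 <= y * t -> 0 <= y * soft e t.
Proof.
move=> e0 yt; rewrite /soft; case: ltP => [et|_].
  have t0 : 0 < t by lra.
  by rewrite mulr_ge0 ?subr_ge0 ?(ltW et)//; move: yt; rewrite pmulr_lge0.
case: ltP => [te|_]; last by rewrite mulr0.
have t0 : t < 0 by lra.
by rewrite mulr_le0 //; [move: yt; rewrite nmulr_lge0|lra].
Qed.

End SoftThreshold.

(** * The nonlinearity *)
Section Problem.
Variables (R : realType) (p : R) (a b : int -> R) (f : int -> R -> R) (lam : R).
Hypothesis p1 : 1 < p.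
Hypothesis a0 : forall k, 0 < a k.
Hypothesis b0 : forall k, 0 < b k.
Hypothesis lam0 : 0 < lam.
Hypothesis hf : forall k, continuous (f k).
Hypothesis f_odd : forall (k : int) (t : R), f k (- t) = - f k t.
Hypothesis f_small : forall eps : R, 0 < eps ->
  \forall t \near (0 : R)^', forall k : int, `|f k t / `|t| `^ (p - 1)| < eps.
Hypothesis f_superlinear : forall k : int, f k t * t / `|t| `^ p @[t --> abs_infty R] --> +oo.
Variable sigma : R.
Hypothesis sigma1 : 1 <= sigma.
Hypothesis calF_scale : forall (k : int) (t s : R), 0 <= s <= 1 ->
  calF p f k (s * t) <= sigma * calF p f k t.
Variable bmin : R.
Hypothesis bmin0 : 0 < bmin.
Hypothesis bminP : forall k, bmin <= b k.
Hypothesis b_oo : forall B : R, exists K : nat, forall k : int, K%:Z < `|k| -> B <= b k.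

Local Notation F := (primF f).
Let p0 : 0 < p. Proof. exact: lt_trans p1. Qed.
Let pge0 : 0 <= p. Proof. exact: ltW. Qed.

Lemma f_zero k : f k 0 = 0.
Proof. by have := f_odd k 0; rewrite oppr0; lra. Qed.

Lemma primFN k t : F k (- t) = F k t.
Proof.
have FN (x : R) : is_derive x 1 (fun s : R => F k (- s)) (f k x).
  have -> : f k x = f k (- x) * -1 by rewrite f_odd mulrN1 opprK.
  apply: (@is_derive1_comp R (F k) (@GRing.opp R)); exact: primF_derive.
have D (x : R) : is_derive x 1 (fun s : R => F k (- s) - F k s) 0.
  by rewrite -(subrr (f k x)); apply: is_deriveB; exact: primF_derive.
have := is_derive_0_is_cst t 0 D; rewrite oppr0 subrr => /eqP.
by rewrite subr_eq0 => /eqP.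
Qed.

Lemma primF_norm k t : F k `|t| = F k t.
Proof. by case: (ger0P t) => // _; rewrite primFN. Qed.

Lemma calF_norm k t : calF p f k `|t| = calF p f k t.
Proof. by rewrite /calF primF_norm; case: (ger0P t) => // _; rewrite f_odd mulrNN. Qed.

Lemma small_f eps : 0 < eps -> exists2 r : R, 0 < r &
  forall k t, `|t| <= r -> `|f k t| <= eps * `|t| `^ (p - 1).
Proof.
move=> e0; have [r /= r0 rP] := f_small e0; exists (r / 2); first by rewrite divr_gt0.
move=> k t tr; have [->|t0] := eqVneq t 0.
  by rewrite f_zero normr0 powR0 ?mulr0// subr_eq0 gt_eqF.
have tr' : `|0 - t| < r by rewrite sub0r normrN; lra.
have := rP t tr' t0 k; move=> /ltW.
rewrite normrM normfV (ger0_norm (powR_ge0 _ _)) ler_pdivrMr//.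
by rewrite powR_gt0 ?normr_gt0.
Qed.

Lemma small_nonlinearity eps : 0 < eps -> exists2 r : R, 0 < r &
  forall k t, `|t| <= r -> `|f k t| <= eps * `|t| `^ (p - 1) /\ `|F k t| <= eps * `|t| `^ p.
Proof.
move=> e0; have [r r0 fr] := small_f e0; exists r => // k t tr; split; first exact: fr.
have [th /andP[th0 th1]] := primF_mvt hf k 0 t; rewrite !add0r primF0// subr0 => ->.
set c := th * t; have ct : `|c| <= `|t| by rewrite normrM ger0_norm// ler_piMl.
rewrite normrM.
apply: le_trans (_ : eps * `|c| `^ (p - 1) * `|t| <= _).
  by rewrite ler_wpM2r//; apply: fr; exact: le_trans tr.
rewrite -mulrA ler_pM2l// -(@mulr_powRB1 _ `|t|)// mulrC ler_wpM2l//.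
by apply: ge0_ler_powR; rewrite ?nnegrE// subr_ge0 ltW.
Qed.

(** The scaling assumption at s = 0. *)
Lemma calF_ge0 k t : 0 <= calF p f k t.
Proof.
have /(_ t) := @calF_scale k ^~ 0; rewrite lexx ler01 mul0r => /(_ isT).
rewrite /calF f_zero mul0r primF0// mulr0 subr0.
by rewrite pmulr_rge0// (lt_le_trans ltr01).
Qed.

(** Mean value theorem for (F + c) / x^p: the sign of calF - p c decides whether
    this ratio increases.  The cases c = 0 and c = sigma calF(k, u) / p are used
    below. *)
Lemma ratio_mvt k (c x y : R) : 0 < x -> x <= y -> exists2 s, x <= s <= y &
  (F k y + c) * y `^ (- p) - (F k x + c) * x `^ (- p) =
  s `^ (- p - 1) * (calF p f k s - p * c) * (y - x).
Proof.
move=> x0 xy.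
pose df s := s `^ (- p - 1) * (calF p f k s - p * c).
have D (s : R) : 0 < s -> is_derive s 1 (fun s : R => (F k s + c) * s `^ (- p)) (df s).
  move=> s0.
  have DF : is_derive s 1 (fun s : R => F k s + c) (f k s + 0).
    by apply: is_deriveD; exact: primF_derive.
  have DP := is_derive1_powR (- p) s0.
  apply: (is_derive_eq (is_deriveM DF DP)).
  rewrite /df /calF.
  have e : s `^ (- p) = s * s `^ (- p - 1).
    rewrite -{2}[s]powRr1 ?ltW// -powRD; first by congr (_ `^ _); ring.
    by apply/implyP => _; rewrite gt_eqF.
  by rewrite /GRing.scale /= e; ring.
have [s||s sxy e] := @MVT_segment R (fun s : R => (F k s + c) * s `^ (- p)) df x y xy.
- by rewrite in_itv /= => /andP[xs _]; apply: D; exact: lt_trans xs.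
- apply: derivable_within_continuous => s; rewrite in_itv /= => /andP[xs _].
  by have := D s (lt_le_trans x0 xs); case.
by exists s; [move: sxy; rewrite in_itv|exact: e].
Qed.

(** F / t^p is nondecreasing on t > 0 and tends to 0 at 0. *)
Lemma primF_ge0 k t : 0 <= F k t.
Proof.
rewrite -primF_norm; have [->|t0] := eqVneq t 0; first by rewrite normr0 primF0.
have {t0} : 0 < `|t| by rewrite normr_gt0.
move: `|t| => {}t t0; rewrite leNgt; apply/negP => Ft.
have tp : 0 < t `^ p by rewrite powR_gt0.
pose eps := - F k t / t `^ p / 2.
have e0 : 0 < eps by rewrite !divr_gt0 ?oppr_gt0.
have [r r0 Fr] := small_nonlinearity e0.
pose x := Num.min r t.
have x0 : 0 < x by rewrite lt_min r0.
have [|s /andP[xs _] E] := @ratio_mvt k 0 x t x0; first by rewrite ge_min lexx orbT.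
have : `|F k x| <= eps * `|x| `^ p by apply: (Fr k x _).2; rewrite (ger0_norm (ltW x0)) ge_min lexx.
rewrite (ger0_norm (ltW x0)) ler_norml => /andP[Fx _].
have xp : 0 < x `^ p by rewrite powR_gt0.
have : 0 <= F k t * t `^ (- p) - F k x * x `^ (- p).
  move: E; rewrite !addr0 => ->; rewrite mulr0 subr0 !mulr_ge0 ?powR_ge0 ?calF_ge0//.
  by rewrite subr_ge0 ge_min lexx orbT.
rewrite !powRN subr_ge0 leNgt => /negP; apply.
rewrite ltr_pdivlMr//; apply: lt_le_trans Fx.
rewrite -mulNr ltr_pM2r// /eps.
have : F k t / t `^ p < 0 by rewrite pmulr_llt0// invr_gt0.
by lra.
Qed.

Let F0 := primF_ge0.
Let cal0 := calF_ge0.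

Lemma f_mul_ge k t : p * F k t <= f k t * t.
Proof. by have := calF_ge0 k t; rewrite /calF subr_ge0. Qed.

Lemma f_mul_ge0 k t : 0 <= f k t * t.
Proof. by apply: le_trans (f_mul_ge k t); rewrite mulr_ge0 ?primF_ge0. Qed.

(** With c = sigma calF(k, u) / p, the ratio (F(k, x) + c) / x^p is nonincreasing
    up to x = u. *)
Lemma primF_scale_ge k t u : 0 <= t <= 1 ->
  t `^ p * F k u - sigma * (1 - t `^ p) / p * calF p f k u <= F k (t * u).
Proof.
move=> /andP[t0 t1]; rewrite -(primF_norm _ u) -(primF_norm _ (t * u)) -(calF_norm _ u).
rewrite normrM (ger0_norm t0); have [->|u0] := eqVneq u 0.
  by rewrite normr0 mulr0 /calF f_zero mul0r primF0// !mulr0 subr0 mulr0 subr0.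
have {u0} : 0 < `|u| by rewrite normr_gt0.
move: `|u| => {}u u0.
move: t0; rewrite le_eqVlt => /predU1P[<-|t0].
  rewrite powR0 ?gt_eqF// mul0r mul0r primF0// sub0r subr0 mulr1 oppr_le0.
  by rewrite mulr_ge0 ?calF_ge0// divr_ge0// (le_trans ler01).
pose c := sigma / p * calF p f k u.
have [||s /andP[ts su] E] := @ratio_mvt k c (t * u) u; first by rewrite mulr_gt0.
  by rewrite ger_pMl.
have : (F k u + c) * u `^ (- p) - (F k (t * u) + c) * (t * u) `^ (- p) <= 0.
  rewrite E mulr_le0_ge0 ?subr_ge0 ?ger_pMl//.
  rewrite mulr_ge0_le0 ?powR_ge0// subr_le0 /c.
  have -> : p * (sigma / p * calF p f k u) = sigma * calF p f k u.
    by field; rewrite gt_eqF.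
  have su1 : 0 <= s / u <= 1.
    rewrite ler_pdivrMr// mul1r su andbT divr_ge0 ?ltW//.
    by apply: lt_le_trans ts; rewrite mulr_gt0.
  by have := @calF_scale k u _ su1; rewrite divfK ?gt_eqF.
rewrite (powRM _ (ltW t0) (ltW u0)) !powRN.
have up : 0 < u `^ p by rewrite powR_gt0.
have tp : 0 < t `^ p by rewrite powR_gt0.
rewrite mulrA -mulrBl pmulr_lle0 ?invr_gt0// subr_le0 ler_pdivlMr//.
rewrite /c; have -> : sigma * (1 - t `^ p) / p * calF p f k u =
  (1 - t `^ p) * (sigma / p * calF p f k u) by ring.
lra.
Qed.

(** The increment of F from t / 2 to t is f at an intermediate point times t / 2,
    and f(k, c) c is superlinear at every c >= t / 2. *)
Lemma primF_superlinear k Lam : exists2 T : R, 0 < T &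
  forall t, T <= `|t| -> Lam * `|t| `^ p <= F k t.
Proof.
have /cvgryPge/(_ (Num.max 0 Lam * 2 `^ p * 2)) [T0 _ T0P] := f_superlinear k.
pose T1 := Num.max T0 0 + 1.
have T10 : 0 < T1 by rewrite /T1 ltr_wpDl// le_max lexx orbT.
exists (2 * T1); first by rewrite mulr_gt0.
move=> t tT; rewrite -primF_norm.
have {tT} : 2 * T1 <= `|t| by [].
have := normr_ge0 t; move: `|t| => {}t t0 tT.
have [th /andP[th0 th1]] := primF_mvt hf k (t / 2) (t / 2).
set c := t / 2 + th * (t / 2).
have -> : t / 2 + t / 2 = t by field.
move=> e; have -> : F k t = F k (t / 2) + f k c * (t / 2) by rewrite -e; ring.
apply: ler_wpDl; first exact: primF_ge0.
have tc : t / 2 <= c by rewrite lerDl mulr_ge0// divr_ge0.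
have ct : c <= t.
  have : th * (t / 2) <= t / 2 by rewrite ler_piMl// divr_ge0.
  by rewrite /c; lra.
have c0 : 0 < c by apply: lt_le_trans tc; lra.
have T0c : T0 < `|c|.
  rewrite (gtr0_norm c0); apply: lt_le_trans tc.
  have : T0 <= Num.max T0 0 by rewrite le_max lexx.
  by move: tT; rewrite /T1; lra.
have cp : 0 < c `^ p by rewrite powR_gt0.
have := T0P c T0c; rewrite (gtr0_norm c0) ler_pdivlMr// => fc.
have fc0 : 0 <= f k c by have := f_mul_ge0 k c; rewrite pmulr_lge0.
apply: le_trans (_ : f k c * c / 2 <= _); last by rewrite -mulrA ler_wpM2l//; lra.
rewrite ler_pdivlMr// [leLHS]mulrAC.
have t2p : (t / 2) `^ p <= c `^ p by apply: ge0_ler_powR; rewrite ?nnegrE ?divr_ge0// ltW.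
have -> : t `^ p = 2 `^ p * (t / 2) `^ p by rewrite -powRM ?divr_ge0// mulrC divfK.
apply: le_trans fc; apply: le_trans (_ : Num.max 0 Lam * 2 * (2 `^ p * (t / 2) `^ p) <= _).
  rewrite ler_wpM2r ?mulr_ge0 ?powR_ge0// ler_wpM2r// le_max lexx orbT//.
have -> : Num.max 0 Lam * 2 * (2 `^ p * (t / 2) `^ p) = Num.max 0 Lam * 2 `^ p * 2 * (t / 2) `^ p by ring.
by rewrite ler_wpM2l// !mulr_ge0 ?powR_ge0// le_max lexx.
Qed.

(** * The functional on a window *)
Definition energy_density (u : int -> R) (k : int) : R :=
  a k * `|u k - u (k - 1)| `^ p + b k * `|u k| `^ p.

Definition gradient (u : int -> R) (k : int) : R :=
  - Delta (fun j => a j * phi p (Delta u (j - 1))) k + b k * phi p (u k)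
  - lam * f k (u k).

Definition Jwin (n : nat) (u : int -> R) : R :=
  p^-1 * (\sum_(k <- window n) energy_density u k)
  - lam * \sum_(k <- window n) F k (u k).

Lemma density_ge0 u k : 0 <= energy_density u k.
Proof. by rewrite addr_ge0// mulr_ge0 ?powR_ge0 ?ltW. Qed.

Let dens0 := density_ge0.

Lemma gradE u k : gradient u k = a k * phi p (u k - u (k - 1))
  - a (k + 1) * phi p (u (k + 1) - u (k + 1 - 1)) + b k * phi p (u k) - lam * f k (u k).
Proof. by rewrite /gradient /Delta /= !addrK; ring. Qed.

Lemma grad_pairing n (u v : int -> R) : supported n v ->
  \sum_(k <- window n.+1) gradient u k * v k =
  \sum_(k <- window n.+1) (a k * phi p (u k - u (k - 1)) * (v k - v (k - 1))
     + b k * phi p (u k) * v k) - lam * \sum_(k <- window n.+1) f k (u k) * v k.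
Proof.
move=> /supported_edge[v1 v2 v3]; rewrite big_split /=.
rewrite (sum_window_by_parts n.+1 (fun k => a k * phi p (u k - u (k - 1))) v).
rewrite v1 v3 !mulr0 addr0 subr0.
rewrite mulr_sumr -big_split -sumrB; apply: eq_bigr => k _; rewrite gradE /=; ring.
Qed.

(** The energy is convex, so for a lower bound only the variation of f between
    u and u + h enters the error term. *)
Lemma Jwin_ascent n (u h : int -> R) (om : R) : supported n h ->
  (forall k, F k (u k + h k) <= F k (u k) + f k (u k) * h k + om * `|h k|) ->
  Jwin n.+1 u + \sum_(k <- window n.+1) gradient u k * h k
    - lam * om * \sum_(k <- window n.+1) `|h k| <= Jwin n.+1 (fun k => u k + h k).
Proof.
move=> hn Fh; rewrite grad_pairing// /Jwin.
have E : p^-1 * (\sum_(k <- window n.+1) energy_density u k) +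
   \sum_(k <- window n.+1) (a k * phi p (u k - u (k - 1)) * (h k - h (k - 1))
     + b k * phi p (u k) * h k) <=
   p^-1 * (\sum_(k <- window n.+1) energy_density (fun k => u k + h k) k).
  rewrite !mulr_sumr -big_split; apply: ler_sum => k _ /=; rewrite /energy_density.
  have A := phi_convex p1 (u k - u (k - 1)) (h k - h (k - 1)).
  have B := phi_convex p1 (u k) (h k).
  have -> : u k + h k - (u (k - 1) + h (k - 1)) =
     u k - u (k - 1) + (h k - h (k - 1)) by ring.
  have := ler_wpM2l (ltW (a0 k)) A; have := ler_wpM2l (ltW (b0 k)) B; lra.
have Fs : \sum_(k <- window n.+1) F k (u k + h k) <=
   \sum_(k <- window n.+1) F k (u k) + \sum_(k <- window n.+1) f k (u k) * h k
   + om * \sum_(k <- window n.+1) `|h k|.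
  by rewrite mulr_sumr -!big_split; apply: ler_sum.
by have := ler_wpM2l (ltW lam0) Fs; lra.
Qed.

Lemma grad_self n (u : int -> R) : supported n u ->
  \sum_(k <- window n.+1) gradient u k * u k =
  \sum_(k <- window n.+1) energy_density u k - lam * \sum_(k <- window n.+1) f k (u k) * u k.
Proof.
move=> un; rewrite grad_pairing//; congr (_ - _); apply: eq_bigr => k _.
by rewrite -[a k * _ * _]mulrA -[b k * _ * _]mulrA !(phi_mul p1).
Qed.

(** Replacing |u(k) - u(k - 1)|^p by 2^p (|u(k)|^p + |u(k - 1)|^p) uncouples the
    sites and bounds the functional above by a sum of one-site terms. *)
Definition site_action (k : int) (t : R) : R :=
  p^-1 * (2 `^ p * (a k + a (k + 1)) + b k) * `|t| `^ p - lam * F k t.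

Lemma Jwin_le_site n (u : int -> R) : supported n u ->
  Jwin n.+1 u <= \sum_(k <- window n.+1) site_action k (u k).
Proof.
move=> un; have -> : \sum_(k <- window n.+1) site_action k (u k) =
    p^-1 * (\sum_(k <- window n.+1) (2 `^ p * (a k + a (k + 1)) + b k) * `|u k| `^ p)
    - lam * \sum_(k <- window n.+1) F k (u k).
  by rewrite !mulr_sumr -sumrB; apply: eq_bigr => k _; rewrite /site_action mulrA.
rewrite /Jwin lerD2r ler_pM2l ?invr_gt0//.
have := sum_window_shift n.+1 (fun k => a (k + 1) * `|u k| `^ p).
have [u1 _ u3] := supported_edge un.
rewrite u1 u3 normr0 powR0 ?gt_eqF//.
under eq_bigr do rewrite subrK.
rewrite !mulr0 addr0 subr0 => e.
apply: le_trans (_ : \sum_(k <- window n.+1)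
  (2 `^ p * (a k * `|u k| `^ p) + 2 `^ p * (a k * `|u (k - 1)| `^ p) + b k * `|u k| `^ p) <= _).
  apply: ler_sum => k _; rewrite /energy_density lerD2r.
  have := ler_wpM2l (ltW (a0 k)) (powR_normD_le p1 (u k) (u (k - 1))).
  by move=> /le_trans; apply; rewrite le_eqVlt; apply/orP; left; apply/eqP; ring.
rewrite !big_split /= -[X in _ + X + _]mulr_sumr e mulr_sumr -!big_split /=.
by apply: ler_sum => k _; rewrite le_eqVlt; apply/orP; left; apply/eqP; ring.
Qed.

Let A k := p^-1 * (2 `^ p * (a k + a (k + 1)) + b k).
Let A0 k : 0 <= A k.
Proof. by rewrite mulr_ge0 ?invr_ge0 ?(ltW p0)// addr_ge0 ?(ltW (b0 _))// mulr_ge0 ?powR_ge0// addr_ge0 ?ltW. Qed.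

Lemma site_coercive k (m : R) : exists2 T : R, 0 < T & forall t, T <= `|t| -> site_action k t <= - m.
Proof.
have [T0 T00 T0P] := primF_superlinear k ((A k + 1) / lam).
exists (Num.max T0 (Num.max 1 m)); first by rewrite lt_max T00.
move=> t; rewrite !ge_max => /and3P[tT t1 tm].
have tp : `|t| <= `|t| `^ p by rewrite le1r_powR// ltW.
rewrite /site_action -/(A k).
have := ler_wpM2l (ltW lam0) (T0P t tT).
have -> : lam * ((A k + 1) / lam * `|t| `^ p) = (A k + 1) * `|t| `^ p.
  by field; rewrite gt_eqF.
lra.
Qed.

Lemma site_bounded k : exists2 D : R, 0 <= D & forall t, site_action k t <= D.
Proof.
have [T T0 TP] := site_coercive k 0.
exists (A k * T `^ p); first by rewrite mulr_ge0 ?powR_ge0.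
move=> t; have [tT|tT] := leP T `|t|.
  by apply: le_trans (TP t tT) _; rewrite oppr0 mulr_ge0 ?powR_ge0.
rewrite /site_action -/(A k); apply: le_trans (_ : A k * `|t| `^ p <= _).
  by rewrite gerBl mulr_ge0// ltW.
rewrite ler_wpM2l//; apply: ge0_ler_powR; rewrite ?nnegrE ?(ltW p0) ?(ltW T0) ?(ltW tT)//.
Qed.

Lemma site0 k : site_action k 0 = 0.
Proof. by rewrite /site_action normr0 powR0 ?gt_eqF// primF0// !mulr0 subrr. Qed.

(** All the one-site terms are bounded above, so a single very negative one makes
    the whole sum negative. *)
Lemma superlevel_bounded n : exists2 B : R, 0 <= B &
  forall u, supported n u -> 0 <= Jwin n.+1 u -> forall k, `|u k| <= B.
Proof.
have /choice[D DP] k : exists D : R, 0 <= D /\ forall t, site_action k t <= D.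
  by have [D ? ?] := site_bounded k; exists D.
pose m := \sum_(k <- window n.+1) D k + 1.
have /choice[T TP] k : exists T : R, 0 < T /\ forall t, T <= `|t| -> site_action k t <= - m.
  by have [T ? ?] := site_coercive k m; exists T.
have T0 k : 0 <= T k by apply/ltW; have [] := TP k.
exists (\sum_(k <- window n) T k); first by rewrite sumr_ge0.
move=> u un Ju k; have [kn|kn] := leP `|k| n%:Z; last first.
  by rewrite un// normr0 sumr_ge0.
apply: le_trans (sum_window_term T0 kn); rewrite leNgt; apply/negP => Tu.
have := le_trans Ju (Jwin_le_site un).
have su : site_action k (u k) <= - m by apply: (TP k).2; exact: ltW.
have kn1 : `|k| <= n.+1%:Z by lia.
have DS j : 0 <= D j - site_action j (u j) by rewrite subr_ge0 (DP j).2.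
have := sum_window_term DS kn1; rewrite sumrB.
have := (DP k).1; move: su; rewrite /m; lra.
Qed.

Lemma level_on_window K : exists C : R, forall n, (K <= n)%N -> forall u,
  supported K u -> Jwin n.+1 u <= C.
Proof.
have /choice[D DP] k : exists D : R, 0 <= D /\ forall t, site_action k t <= D.
  by have [D ? ?] := site_bounded k; exists D.
exists (\sum_(k <- window K) D k) => n Kn u uK.
have un : supported n u by move=> k kn; apply: uK; lia.
apply: le_trans (Jwin_le_site un) _.
rewrite (@sum_window_widen _ K); first by apply: ler_sum => k _; exact: (DP k).2.
  by move=> k kK; rewrite uK// site0.
by lia.
Qed.

(** For |t| <= d the term lam F(k, t) is at most half of b(k) |t|^p / p, uniformly
    in k. *)
Lemma small_level : exists2 d : R, 0 < d & forall n u, (forall k, `|u k| <= d) ->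
  (2 * p)^-1 * (\sum_(k <- window n) b k * `|u k| `^ p) <= Jwin n u.
Proof.
pose eps := bmin / (2 * p * lam).
have e0 : 0 < eps by rewrite divr_gt0// !mulr_gt0.
have [d d0 dP] := small_nonlinearity e0; exists d => // n u ud.
rewrite /Jwin.
have dens : \sum_(k <- window n) b k * `|u k| `^ p <= \sum_(k <- window n) energy_density u k.
  by apply: ler_sum => k _; rewrite /energy_density lerDr mulr_ge0 ?powR_ge0// ltW.
have Fs : lam * \sum_(k <- window n) F k (u k) <=
    (2 * p)^-1 * \sum_(k <- window n) b k * `|u k| `^ p.
  rewrite !mulr_sumr; apply: ler_sum => k _.
  have := ler_wpM2l (ltW lam0) (le_trans (ler_norm _) (dP k (u k) (ud k)).2).
  move=> /le_trans; apply.
  have -> : lam * (eps * `|u k| `^ p) = (2 * p)^-1 * (bmin * `|u k| `^ p).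
    by rewrite /eps; field; rewrite !gt_eqF.
  by rewrite ler_wpM2l ?invr_ge0 ?mulr_ge0 ?(ltW p0)// ler_wpM2r ?powR_ge0.
have ip : p^-1 = (2 * p)^-1 + (2 * p)^-1 by field; rewrite gt_eqF.
have i0 : 0 < (2 * p)^-1 by rewrite invr_gt0 mulr_gt0.
have := ler_wpM2l (ltW i0) dens.
rewrite ip; lra.
Qed.

Lemma grad_pointwise_continuous : pointwise_continuous gradient.
Proof.
move=> U UU X x Xx k; rewrite gradE.
under eq_fun do rewrite gradE.
have phic y z : (X n y - X n z) @[n --> U] --> x y - x z by apply: cvgB.
have phi_c (Y : nat -> R) y : Y n @[n --> U] --> y -> phi p (Y n) @[n --> U] --> phi p y.
  by move=> Yy; apply: continuous_cvg => //; exact: phi_continuous.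
apply: cvgB; last by apply: cvgMr; apply: continuous_cvg => //; exact: hf.
apply: cvgD; last by apply: cvgMr; exact: phi_c.
by apply: cvgB; apply: cvgMr; exact: phi_c.
Qed.

Lemma gradN u k : gradient (fun j => - u j) k = - gradient u k.
Proof. by rewrite !gradE -!opprD !phiN f_odd; ring. Qed.

Lemma grad_bounded (B : R) k : exists2 G : R, 0 <= G &
  forall u, (forall j, `|u j| <= B) -> `|gradient u k| <= G.
Proof.
apply: contrapT => nG.
have /choice[X XP] (m : nat) : exists u : int -> R, (forall j, `|u j| <= B) /\ m%:R < `|gradient u k|.
  apply: contrapT => nu; apply: nG; exists m%:R => // u uB.
  by rewrite leNgt; apply/negP => gm; apply: nu; exists u.
have [U [UU sU]] := @ultraFilterLemma nat \oo _.
have /choice[x xP] (j : int) : exists x : R, `|x| <= B /\ X n j @[n --> U] --> x.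
  by apply: ultra_bounded_cvg; apply: nearW => n; have [] := XP n.
have Xx j : X n j @[n --> U] --> x j by have [] := xP j.
have lim : `|gradient (X n) k| @[n --> U] --> `|gradient x k|.
  by apply: cvg_norm; exact: grad_pointwise_continuous.
have near1 : \forall n \near U, `|gradient (X n) k| < `|gradient x k| + 1.
  by apply: (cvgr_lt _ lim); rewrite ltrDl.
have [N /ltW NP] : exists N : nat, `|gradient x k| + 1 < N%:R.
  by exists (Num.bound (`|gradient x k| + 1)); apply: archi_boundP; rewrite addr_ge0.
have near2 : \forall n \near U, (N <= n)%N by apply: sU; exists N.
have [n [n1 n2]] := filter_ex (filterI near1 near2).
have [_ Xn] := XP n; have := lt_trans Xn (lt_le_trans n1 NP).
by rewrite ltr_nat ltnNge n2.
Qed.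

(** * Gradient ascent and almost critical points *)
Lemma uniform_continuity_list (s : seq int) (B om : R) : 0 < om ->
  exists2 r : R, 0 < r & forall k t h, k \in s -> `|t| <= B -> `|h| <= r ->
    `|f k (t + h) - f k t| <= om.
Proof.
move=> om0; elim: s => [|j s [r r0 IH]]; first by exists 1.
have [q q0 qP] := @uniform_continuity_segment R (f j) B om (@hf j) om0.
exists (Num.min r q); first by rewrite lt_min r0.
move=> k t h; rewrite inE le_min => /orP[/eqP-> tB /andP[_ hq]|ks tB /andP[hr _]].
  exact: qP.
exact: IH.
Qed.

Definition step (n : nat) (tau : R) (u : int -> R) (k : int) : R :=
  u k + (if `|k| <= n%:Z then tau * gradient u k else 0).

Lemma step_supported n tau u : supported n u -> supported n (step n tau u).
Proof. by move=> un k kn; rewrite /step un// leNgt kn addr0. Qed.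

Lemma stepN n tau u k : step n tau (fun j => - u j) k = - step n tau u k.
Proof. by rewrite /step gradN//; case: ifP => _; ring. Qed.

Lemma step_continuous n tau : pointwise_continuous (step n tau).
Proof.
move=> U UU X x Xx k; rewrite /step; apply: cvgD; first exact: Xx.
case: ifP => _; last exact: cvg_cst.
by apply: cvgMr; exact: grad_pointwise_continuous.
Qed.

(** A step of fixed size tau gains at least gam where the gradient is larger than
    eta.  Above the level C + 1 it may lose, but less than 1, so that the level
    stays above C. *)
Lemma ascent_step n (M C eta : R) : 0 <= M -> 0 < eta ->
  (forall u, supported n u -> M <= Jwin n.+1 u <= C + 1 ->
     exists2 k, `|k| <= n%:Z & eta < `|gradient u k|) ->
  exists tau gam : R, 0 < gam /\ forall u, supported n u -> M <= Jwin n.+1 u ->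
     Num.min C (Jwin n.+1 u + gam) <= Jwin n.+1 (step n tau u).
Proof.
move=> M0 eta0 noncrit.
have [B B0 BP] := superlevel_bounded n.
have /choice[G0 G0P] k : exists G : R, 0 <= G /\ forall u, (forall j, `|u j| <= B) -> `|gradient u k| <= G.
  by have [G ? ?] := grad_bounded B k; exists G.
pose G := \sum_(k <- window n) G0 k + 1.
have G1 : 1 <= G by rewrite lerDr sumr_ge0// => k _; have [] := G0P k.
have GP u k : supported n u -> M <= Jwin n.+1 u -> `|k| <= n%:Z -> `|gradient u k| <= G.
  move=> un MJ kn; have uB := BP u un (le_trans M0 MJ).
  apply: le_trans ((G0P k).2 _ uB) _; apply: ler_wpDr => //.
  by apply: sum_window_term => // j; have [] := G0P j.
pose N : R := n.*2.+1%:R.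
have N0 : 0 < N by rewrite /N.
(* with this modulus the error of one step is at most half of tau eta^2 *)
pose om := eta ^+ 2 / (2 * lam * G * N).
have eta2 : 0 < eta ^+ 2 by rewrite exprn_gt0.
have Gp : 0 < G by lra.
have om0 : 0 < om by rewrite divr_gt0// !mulr_gt0.
have [r r0 rP] := @uniform_continuity_list (window n) B om om0.
pose tau := Num.min (r / G) (2 / eta ^+ 2).
have tau0 : 0 < tau by rewrite lt_min !divr_gt0.
have tauG : tau * G <= r by rewrite -ler_pdivlMr// ge_min lexx.
have tau_eta : tau * eta ^+ 2 / 2 <= 1.
  by rewrite ler_pdivrMr// mul1r -ler_pdivlMr// ge_min lexx orbT.
exists tau, (tau * eta ^+ 2 / 2); split; first by rewrite divr_gt0// mulr_gt0.
move=> u un MJ; have uB := BP u un (le_trans M0 MJ).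
pose h k := if `|k| <= n%:Z then tau * gradient u k else 0.
have hn : supported n h by move=> k kn; rewrite /h leNgt kn.
have Fh k : F k (u k + h k) <= F k (u k) + f k (u k) * h k + om * `|h k|.
  have [kn|kn] := leP `|k| n%:Z; last by rewrite hn// normr0 !mulr0 !addr0.
  have [th /andP[th0 th1]] := primF_mvt hf k (u k) (h k).
  move=> e; have -> : F k (u k + h k) = F k (u k) + f k (u k + th * h k) * h k by rewrite -e; ring.
  rewrite -addrA lerD2l -lerBlDl -mulrBl; apply: le_trans (ler_norm _) _.
  rewrite normrM ler_wpM2r//; apply: rP => //; first by rewrite mem_window.
  rewrite normrM (ger0_norm th0); apply: le_trans (_ : `|h k| <= _); first by rewrite ler_piMl.
  rewrite /h kn normrM (gtr0_norm tau0); apply: le_trans tauG.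
  by rewrite ler_wpM2l ?(ltW tau0)// GP.
have asc := Jwin_ascent hn Fh.
have S1 : \sum_(k <- window n.+1) gradient u k * h k = tau * \sum_(k <- window n) gradient u k ^+ 2.
  rewrite (@sum_window_widen _ n)//; last by move=> k kn; rewrite hn// mulr0.
  by rewrite mulr_sumr; apply: eq_sum_window => k kn; rewrite /h kn; ring.
have S2 : \sum_(k <- window n.+1) `|h k| <= tau * (G * N).
  rewrite (@sum_window_widen _ n)//; last by move=> k kn; rewrite hn// normr0.
  apply: le_trans (_ : \sum_(k <- window n) tau * G <= _).
    apply: le_sum_window => k kn; rewrite /h kn normrM (gtr0_norm tau0).
    by rewrite ler_wpM2l ?(ltW tau0)// GP.
  by rewrite sum_window_cst -mulr_natr mulrA.
have S3 : lam * om * \sum_(k <- window n.+1) `|h k| <= tau * eta ^+ 2 / 2.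
  apply: le_trans (ler_wpM2l _ S2) _; first by rewrite mulr_ge0// ltW.
  rewrite le_eqVlt; apply/orP; left; apply/eqP; rewrite /om; field.
  by rewrite !gt_eqF.
have S4 : 0 <= tau * \sum_(k <- window n) gradient u k ^+ 2.
  by rewrite mulr_ge0 ?(ltW tau0)// sumr_ge0// => k _; exact: sqr_ge0.
rewrite S1 in asc; rewrite -[step n tau u]/(fun k => u k + h k).
rewrite ge_min; apply/orP; have [JC|JC] := leP (Jwin n.+1 u) (C + 1); last by left; lra.
right; have [k kn gk] := noncrit u un (introT andP (conj MJ JC)).
have S5 : tau * eta ^+ 2 <= tau * \sum_(k <- window n) gradient u k ^+ 2.
  rewrite ler_wpM2l ?(ltW tau0)//.
  have := @sum_window_term R n (fun k => gradient u k ^+ 2) k (fun j => sqr_ge0 _) kn.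
  apply: le_trans; rewrite -[leRHS]real_normK ?num_real//.
  by rewrite lerXn2r ?nnegrE ?(ltW eta0)// ltW.
lra.
Qed.

Lemma ascent n (M C eta : R) : 0 <= M -> M <= C -> 0 < eta ->
  (forall u, supported n u -> M <= Jwin n.+1 u <= C + 1 ->
     exists2 k, `|k| <= n%:Z & eta < `|gradient u k|) ->
  exists (L : nat) (tau : R), forall u, supported n u -> M <= Jwin n.+1 u ->
     C <= Jwin n.+1 (iter L (step n tau) u).
Proof.
move=> M0 MC eta0 noncrit; have [tau [gam [gam0 T]]] := ascent_step M0 eta0 noncrit.
have it L u : supported n u -> M <= Jwin n.+1 u ->
    supported n (iter L (step n tau) u) /\
    Num.min C (M + L%:R * gam) <= Jwin n.+1 (iter L (step n tau) u).
  move=> un MJ; elim: L => [|L [IHs IHJ]].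
    by split=> //; rewrite mul0r addr0 ge_min MJ orbT.
  split; first exact: step_supported.
  rewrite iterS; apply: le_trans (T _ IHs _); last first.
    by apply: le_trans IHJ; rewrite le_min MC lerDl mulr_ge0// ltW.
  move: IHJ; rewrite le_min !ge_min lexx /= => /orP[CJ|LJ].
    by apply/orP; left; move: CJ => /le_trans; apply; rewrite lerDl ltW.
  by apply/orP; right; rewrite -natr1; lra.
pose L := Num.bound ((C - M) / gam).
exists L, tau => u un MJ; have [_] := it L u un MJ; apply: le_trans.
rewrite le_min lexx /= -lerBlDl -ler_pdivrMr//; apply/ltW/archi_boundP.
by rewrite divr_ge0 ?subr_ge0// ltW.
Qed.

Lemma iter_step_continuous L n tau : pointwise_continuous (iter L (step n tau)).
Proof.
elim: L => [|L IH] U UU X x Xx k /=; first exact: Xx.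
by apply: step_continuous => j; exact: IH.
Qed.

Lemma iter_stepN L n tau u : iter L (step n tau) (fun j => - u j) = (fun j => - iter L (step n tau) u j).
Proof. by elim: L => [//|L /= ->]; apply/funext => k; rewrite stepN. Qed.

(** Borsuk-Ulam is applied on the sites K < |k| <= n other than K + 1, the point x
    of the cube being sent to d x on these sites and to d (1 - max |x|) at the
    site K + 1.  This map is odd on the boundary of the cube, and its values
    have sup norm between d / 2 and d. *)
Theorem almost_critical_points :
  exists2 d : R, 0 < d & forall K M, 0 <= M ->
    (forall k, K%:Z < `|k| -> M <= (2 * p)^-1 * (b k * d `^ p)) ->
  exists C, forall n eta, (K < n)%N -> 0 < eta ->
    exists u, [/\ supported n u, M <= Jwin n.+1 u <= C &
      forall k, `|k| <= n%:Z -> `|gradient u k| <= eta].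
Proof.
have [d d0 dP] := small_level.
exists (d / 2); first by rewrite divr_gt0.
move=> K M M0 KM.
have [C0 C0P] := level_on_window K.+1.
pose C := Num.max (C0 + 1) M.
have C0C : C0 < C by rewrite lt_max ltrDl ltr01.
have MC : M <= C by rewrite le_max lexx orbT.
exists (C + 1) => n eta Kn eta0; apply: contrapT => nocrit.
(* no almost critical point: ascent reaches the level C from the level M *)
have [|L [tau LP]] := @ascent n M C eta M0 MC eta0.
  move=> u un uJ; apply: contrapT => nk; apply: nocrit; exists u; split=> // k kn.
  by rewrite leNgt; apply/negP => gk; apply: nk; exists k.
pose sites := [seq k <- window n | (K%:Z < `|k|) && (k != K.+1%:Z)].
pose I : finType := seq_sub sites.
pose mx (x : I -> R) := \big[Num.max/0]_i `|x i|.
pose start (x : I -> R) (k : int) : R :=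
  if k == K.+1%:Z then d * (1 - mx x) else oapp (fun i => d * x i) 0 (insub k).
have startE x (i : I) : start x (val i) = d * x i.
  have := valP i; rewrite mem_filter /start => /andP[/andP[_ /negbTE ->] _].
  by rewrite valK.
have start0 x k : k != K.+1%:Z -> k \notin sites -> start x k = 0.
  by move=> /negbTE kK ks; rewrite /start kK insubF//; apply/negbTE.
pose G (x : I -> R) (i : I) := iter L (step n tau) (start x) (val i).
have mx1 x : (forall i, `|x i| <= 1) -> 0 <= mx x <= 1.
  move=> x1; rewrite /mx; apply/andP; split; first exact: bigmax_ge_id.
  by apply/bigmax_leP; split=> // i _.
have [x x1 [i xi] j||x [x1 Gx]] := @borsuk_ulam R I G.
- have mxE : mx x = 1.
    apply/eqP; rewrite eq_le; have /andP[_ ->] := mx1 x x1; rewrite /= -xi.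
    exact: le_bigmax.
  have mxN : mx (fun i => - x i) = 1 by rewrite -mxE; apply: eq_bigr => k _; rewrite normrN.
  rewrite /G -[RHS]/((fun k => - iter L (step n tau) (start x) k) (val j)) -iter_stepN.
  congr (iter _ _ _ _); apply/funext => k; rewrite /start.
  case: ifP => _; first by rewrite mxE mxN subrr mulr0 oppr0.
  by case: (insub k) => [q|] /=; rewrite ?oppr0// mulrN.
- move=> U UU X x Xx i; rewrite /G; apply: iter_step_continuous => k.
  rewrite /start; case: ifP => _.
    by apply: cvgMr; apply: cvgB; [exact: cvg_cst|exact: cvg_bigmax_norm].
  by case: (insub k) => [q|] /=; [apply: cvgMr; exact: Xx|exact: cvg_cst].
have /andP[mx0 mxle1] := mx1 x x1.
have sn : supported n (start x).
  move=> k kn; apply: start0.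
    by apply/eqP => e; move: kn; rewrite e norm_natz ltz_nat ltnNge Kn.
  by rewrite mem_filter mem_window leNgt kn andbF.
have sd k : `|start x k| <= d.
  rewrite /start; case: ifP => _.
    by rewrite normrM (gtr0_norm d0) ler_piMr ?(ltW d0)// ger0_norm; lra.
  case: (insub k) => [q|] /=; last by rewrite normr0 ltW.
  by rewrite normrM (gtr0_norm d0) ler_piMr ?(ltW d0)// x1.
have MJ : M <= Jwin n.+1 (start x).
  have [k [Kk kn sk]] : exists k, [/\ K%:Z < `|k|, `|k| <= n.+1%:Z & d / 2 <= `|start x k|].
    have [mxh|mxh] := leP (mx x) (2^-1).
      exists K.+1%:Z; split; [by rewrite norm_natz ltz_nat|by rewrite norm_natz lez_nat ltnW|].
      rewrite /start eqxx normrM (gtr0_norm d0) ler_wpM2l ?(ltW d0)// ger0_norm; lra.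
    have [i xi] : exists i, 2^-1 < `|x i|.
      apply: contrapT => nx; move: mxh; rewrite ltNge => /negP; apply.
      apply/bigmax_leP; split=> // i _; rewrite leNgt; apply/negP => xi.
      by apply: nx; exists i.
    exists (val i); have := valP i; rewrite mem_filter mem_window => /andP[/andP[Kk _] kn].
    split=> //; first exact: le_succz.
    by rewrite startE normrM (gtr0_norm d0) ler_wpM2l ?(ltW d0)// ltW.
  apply: le_trans (dP n.+1 (start x) sd).
  apply: le_trans (KM k Kk) _.
  rewrite ler_wpM2l ?invr_ge0 ?mulr_ge0 ?(ltW p0)//.
  have bs j : 0 <= b j * `|start x j| `^ p by rewrite mulr_ge0 ?powR_ge0// ltW.
  apply: le_trans (sum_window_term bs kn).
  rewrite ler_wpM2l ?(ltW (b0 k))//; apply: ge0_ler_powR => //; rewrite ?nnegrE ?(ltW p0)//.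
  by rewrite divr_ge0// ltW.
have := LP _ sn MJ; rewrite leNgt => /negP; apply.
apply: le_lt_trans C0C; apply: (C0P n) => // k kK.
have [kn|kn] := leP `|k| n%:Z; last first.
  have isn : supported n (iter L (step n tau) (start x)).
    by elim: (L) => [//|L' IH]; exact: step_supported.
  exact: isn.
have ks : k \in sites.
  rewrite mem_filter mem_window kn andbT; apply/andP; split; first exact: lt_succz.
  by apply/eqP => e; move: kK; rewrite e norm_natz ltz_nat ltnn.
by have := Gx (SeqSub ks).
Qed.

(** * Energy bound for almost critical points *)
Lemma density_scale t u k : 0 <= t -> energy_density (fun j => t * u j) k = t `^ p * energy_density u k.
Proof.
move=> t0; rewrite /energy_density -mulrBr !normrM (ger0_norm t0) !powRM//; ring.
Qed.

Lemma calF_sum n u : supported n u ->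
  lam * \sum_(k <- window n.+1) calF p f k (u k) =
  p * Jwin n.+1 u - \sum_(k <- window n.+1) gradient u k * u k.
Proof.
move=> un; rewrite grad_self// /Jwin /calF sumrB -mulr_sumr.
by rewrite !mulrBr mulVKf ?gt_eqF//; ring.
Qed.

(** Summing [primF_scale_ge] over the sites bounds Jwin(t u) by t^p Jwin(u) and a
    multiple of the sum of calF(k, u(k)), which is itself controlled by the level
    and by the derivative along u. *)
Lemma Jwin_ray n (C : R) u t : supported n u -> 0 <= t <= 1 -> Jwin n.+1 u <= C -> 0 <= C ->
  `|\sum_(k <- window n.+1) gradient u k * u k| <= 1 ->
  Jwin n.+1 (fun k => t * u k) <= C + sigma * (C + p^-1).
Proof.
move=> un t01 JC C0 g1; have /andP[t0 t1] := t01.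
have tp1 : t `^ p <= 1 by have := @ge0_ler_powR R p (ltW p0) t 1; rewrite !nnegrE powR1; apply.
have tp0 := powR_ge0 t p.
pose S := \sum_(k <- window n.+1) calF p f k (u k).
have Fs : t `^ p * \sum_(k <- window n.+1) F k (u k) - sigma * (1 - t `^ p) / p * S
    <= \sum_(k <- window n.+1) F k (t * u k).
  rewrite !mulr_sumr -sumrB; apply: ler_sum => k _.
  exact: primF_scale_ge.
have Dt : \sum_(k <- window n.+1) energy_density (fun j => t * u j) k =
    t `^ p * \sum_(k <- window n.+1) energy_density u k.
  by rewrite mulr_sumr; apply: eq_bigr => k _; rewrite density_scale.
have := ler_wpM2l (ltW lam0) Fs; rewrite /Jwin Dt.
have SE : lam * S <= p * C + 1.
  rewrite calF_sum//; have := ler_wpM2l (ltW p0) JC.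
  by move: g1; rewrite ler_norml; lra.
have S0 : 0 <= S by apply: sumr_ge0.
have X : sigma * (1 - t `^ p) / p * (lam * S) <= sigma * (C + p^-1).
  have -> : sigma * (C + p^-1) = sigma / p * (p * C + 1) by field; rewrite gt_eqF.
  have s0 : 0 < sigma / p by rewrite divr_gt0// (lt_le_trans ltr01).
  have -> : sigma * (1 - t `^ p) / p * (lam * S) = sigma / p * ((1 - t `^ p) * (lam * S)) by ring.
  rewrite ler_pM2l//; apply: le_trans SE.
  by rewrite ler_piMl ?mulr_ge0 ?(ltW lam0)//; lra.
have Y : t `^ p * Jwin n.+1 u <= C.
  by apply: le_trans (ler_wpM2l tp0 JC) _; rewrite ler_piMl.
move: Y; rewrite /Jwin; set D := \sum_(k <- _) energy_density _ _; set Fu := \sum_(k <- _) F _ _.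
rewrite -/Fu; move: X; set FF := \sum_(k <- _) F _ _; lra.
Qed.

(** If the energy of u is large, scale u down to v = t u of energy rho.  By
    [Jwin_ray] the level at v is at most C3, which is less than rho / p, so F
    must contribute at v and some |v(k)| is larger than r, with k in a fixed
    window because b -> +oo.  Then u(k) is a fixed fraction of the p-th root of
    the energy of u, and if it were too large the superlinear term F(k, u(k))
    would make the level of u negative. *)
Lemma energy_bound (C : R) : 0 <= C -> exists E : R, forall n u, supported n u ->
  0 < Jwin n.+1 u -> Jwin n.+1 u <= C ->
  `|\sum_(k <- window n.+1) gradient u k * u k| <= 1 ->
  \sum_(k <- window n.+1) energy_density u k <= E.
Proof.
move=> C0; pose C3 := C + sigma * (C + p^-1).
have C30 : 0 <= C3.
  by rewrite addr_ge0// mulr_ge0 ?(le_trans ler01 sigma1)// addr_ge0// invr_ge0 ltW.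
pose rho := p * (C3 + 2).
have rho0 : 0 < rho by rewrite mulr_gt0//; lra.
pose eps := bmin / (lam * rho).
have eps0 : 0 < eps by rewrite divr_gt0// mulr_gt0.
have [r r0 rP] := small_nonlinearity eps0.
have rp0 : 0 < r `^ p by rewrite powR_gt0.
have [K KP] := b_oo (rho / r `^ p).
(* for this slope lam F(k, u(k)) alone outweighs the energy of u divided by p *)
pose Lam := rho / (p * lam * r `^ p).
have /choice[T TP] k : exists T : R, 0 < T /\ forall t, T <= `|t| -> Lam * `|t| `^ p <= F k t.
  by have [T ? ?] := primF_superlinear k Lam; exists T.
pose Tm := \sum_(k <- window K) T k.
have Tk0 k : 0 <= T k by have [/ltW] := TP k.
have Tm0 : 0 <= Tm by apply: sumr_ge0.
pose E2 := rho * Tm `^ p / r `^ p.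
have E20 : 0 <= E2.
  by apply: divr_ge0; [apply: mulr_ge0; [exact: ltW|exact: powR_ge0]|exact: ltW].
exists (rho + E2) => n u un J0 JC g1.
set E := \sum_(k <- _) _.
have [Er|rE] := leP E rho; first by apply: le_trans Er _; rewrite lerDl.
apply: le_trans (_ : E2 <= _); last by rewrite lerDr (ltW rho0).
have Ep : 0 < E by exact: lt_trans rE.
pose t := (rho / E) `^ p^-1.
have tp : t `^ p = rho / E.
  by rewrite /t -powRrM mulVf ?gt_eqF// powRr1// divr_ge0 ?ltW.
have t0 : 0 < t by rewrite powR_gt0// divr_gt0.
have t1 : t <= 1.
  rewrite leNgt; apply/negP => t1; have : 1 < t `^ p.
    by have := @gt0_ltr_powR R p p0 1 t; rewrite powR1 !nnegrE ler01 (ltW t0); apply.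
  by rewrite tp ltr_pdivlMr// mul1r; lra.
have Jt : Jwin n.+1 (fun k => t * u k) <= C3 by apply: Jwin_ray => //; rewrite (ltW t0).
have Edt : \sum_(k <- window n.+1) energy_density (fun k => t * u k) k = rho.
  rewrite (eq_bigr (fun k => t `^ p * energy_density u k)) => [|k _]; last first.
    by rewrite density_scale// ltW.
  by rewrite -mulr_sumr tp divfK// gt_eqF.
have Ft : 2 <= lam * \sum_(k <- window n.+1) F k (t * u k).
  move: Jt; rewrite /Jwin Edt /rho mulKf ?gt_eqF//; lra.
have bd v k : b k * `|v k| `^ p <= energy_density v k.
  by rewrite /energy_density lerDr mulr_ge0 ?powR_ge0// ltW.
have [k rk] : exists k, r < `|t * u k|.
  apply: contrapT => nr; have ru k : `|t * u k| <= r.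
    by rewrite leNgt; apply/negP => rk; apply: nr; exists k.
  suff : lam * \sum_(k <- window n.+1) F k (t * u k) <= 1 by lra.
  have -> : 1 = lam * eps / bmin * rho.
    by rewrite /eps; field; rewrite !gt_eqF.
  rewrite -Edt !mulr_sumr; apply: ler_sum => k _.
  have -> : lam * eps / bmin * energy_density (fun j => t * u j) k =
     lam * (eps * (energy_density (fun j => t * u j) k / bmin)) by ring.
  rewrite ler_pM2l//; apply: le_trans (ler_norm _) _.
  apply: le_trans (rP k _ (ru k)).2 _; rewrite ler_pM2l// ler_pdivlMr// mulrC.
  apply: le_trans (bd (fun j => t * u j) k).
  by rewrite ler_wpM2r ?powR_ge0.
have kn : `|k| <= n%:Z.
  rewrite leNgt; apply/negP => kn; move: rk; rewrite un// mulr0 normr0.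
  by rewrite ltNge ltW.
have kn1 : `|k| <= n.+1%:Z by exact: le_succz.
have rpk : r `^ p < `|t * u k| `^ p by rewrite gt0_ltr_powR// nnegrE ltW.
have kK : `|k| <= K%:Z.
  rewrite leNgt; apply/negP => /KP; rewrite ler_pdivrMr//; apply/negP; rewrite -ltNge.
  rewrite -Edt; apply: lt_le_trans (sum_window_term (fun j => dens0 _ _) kn1).
  by apply: lt_le_trans (bd (fun j => t * u j) k); rewrite ltr_pM2l.
have Eu : E * r `^ p < rho * `|u k| `^ p.
  move: rpk; rewrite normrM (gtr0_norm t0) powRM ?(ltW t0)// tp.
  by rewrite mulrAC ltr_pdivlMr// mulrC.
have [Tu|uT] := leP (T k) `|u k|.
  exfalso; move: J0; apply/negP; rewrite -leNgt /Jwin -/E.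
  have Fk : F k (u k) <= \sum_(j <- window n.+1) F j (u j).
    exact: (sum_window_term (F := fun j => F j (u j)) (fun j => F0 _ _) kn1).
  have := ler_wpM2l (ltW lam0) (le_trans ((TP k).2 _ Tu) Fk).
  suff : p^-1 * E <= lam * (Lam * `|u k| `^ p) by lra.
  have -> : lam * (Lam * `|u k| `^ p) = p^-1 * (rho * `|u k| `^ p / r `^ p).
    by rewrite /Lam; field; rewrite !gt_eqF.
  by rewrite ler_pM2l ?invr_gt0// ler_pdivlMr// ltW.
rewrite /E2 ler_pdivlMr//; apply: le_trans (ltW Eu) _.
rewrite ler_pM2l//; apply: ge0_ler_powR; rewrite ?nnegrE ?(ltW p0)//.
by apply: le_trans (ltW uT) _; exact: sum_window_term.
Qed.

(** * Passage to the limit *)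
Lemma energyE (u : int -> R) : energy p a b u = \esum_(k in [set: int]) (energy_density u k)%:E.
Proof. by apply: eq_esum => k _; rewrite /Delta subrK. Qed.

Lemma vanishing_of_bound (u : int -> R) (E : R) : (forall k, b k * `|u k| `^ p <= E) ->
  forall e, 0 < e -> exists K : nat, forall k : int, K%:Z < `|k| -> `|u k| <= e.
Proof.
move=> uE e e0; have [K KP] := b_oo ((E + 1) / e `^ p); exists K => k kK.
have ep : 0 < e `^ p by rewrite powR_gt0.
have := KP k kK; rewrite ler_pdivrMr// => h; rewrite leNgt; apply/negP => eu.
have : b k * e `^ p <= b k * `|u k| `^ p.
  by rewrite ler_pM2l//; apply: ge0_ler_powR; rewrite ?nnegrE ?(ltW p0) ?(ltW e0) ?(ltW eu).
by have := uE k; lra.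
Qed.

Lemma b_term_le_density m (u : int -> R) k : `|k| <= m%:Z ->
  b k * `|u k| `^ p <= \sum_(k <- window m) energy_density u k.
Proof.
move=> km; apply: le_trans (sum_window_term (dens0 u) km).
by rewrite /energy_density lerDr mulr_ge0 ?powR_ge0// ltW.
Qed.

(** The equation is tested against [soft e] of u, which has finite support, and
    then e tends to 0.  Testing against u itself would need the boundary terms
    a(k) phi(u(k) - u(k - 1)) u(k) to vanish at infinity, which is unclear when
    a is unbounded. *)
Lemma energy_ge_work (u : int -> R) (E : R) : (forall k, gradient u k = 0) ->
  (forall m, \sum_(k <- window m) energy_density u k <= E) ->
  forall m, lam * \sum_(k <- window m) f k (u k) * u k <= E.
Proof.
move=> gu uE m.
have fu0 k : 0 <= f k (u k) * u k by exact: f_mul_ge0.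
have ub k : b k * `|u k| `^ p <= E.
  by apply: le_trans (uE `|k|%N); apply: b_term_le_density; rewrite abszE.
pose S := \sum_(k <- window m) `|f k (u k)|.
have S0 : 0 <= S by apply: sumr_ge0.
have key e : 0 < e -> lam * \sum_(k <- window m) f k (u k) * u k <= E + lam * S * e.
  move=> e0; have [K KP] := vanishing_of_bound ub e0.
  pose v k := soft e (u k); pose n := maxn m K.
  have vn : supported n v.
    move=> k kn; apply: soft_small; apply: KP; apply: le_lt_trans kn.
    by rewrite lez_nat leq_maxr.
  have fv0 k : 0 <= f k (u k) * v k by apply: soft_sign.
  have := grad_pairing u vn.
  rewrite (eq_bigr (fun=> 0)) => [|k _]; last by rewrite gu mul0r.
  rewrite big1// => /esym/eqP; rewrite subr_eq0 => /eqP gp.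
  have work : lam * \sum_(k <- window n.+1) f k (u k) * v k <= E.
    rewrite -gp; apply: le_trans (uE n.+1); apply: ler_sum => k _.
    rewrite /energy_density -[a k * _ * _]mulrA -[b k * _ * _]mulrA; apply: lerD.
      by rewrite ler_pM2l//; apply: (phi_mul_le p1); exact: soft_lipschitz.
    by rewrite ler_pM2l//; apply: (phi_mul_le p1); exact: soft_norm.
  have sub : lam * \sum_(k <- window m) f k (u k) * v k <= E.
    apply: le_trans work; rewrite ler_pM2l//.
    by apply: sum_window_mono => //; apply: leqW; exact: leq_maxl.
  apply: le_trans (_ : lam * (\sum_(k <- window m) f k (u k) * v k + S * e) <= _).
    rewrite ler_pM2l// mulr_suml -big_split; apply: ler_sum => k _ /=.
    rewrite -lerBlDl -mulrBr; apply: le_trans (ler_norm _) _.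
    rewrite normrM ler_wpM2l// distrC; exact: soft_near.
  by rewrite mulrDr mulrA lerD2r.
apply/ler_addgt0Pr => d d0.
have c0 : 0 < lam * S + 1 by rewrite ltr_pwDr// mulr_ge0// ltW.
apply: le_trans (key (d / (lam * S + 1)) _) _; first by rewrite divr_gt0.
rewrite lerD2l mulrA ler_pdivrMr// mulrC ler_wpM2l ?(ltW d0)//.
by rewrite lerDl.
Qed.

(** If the energy equals lam times the sum of f(k, u(k)) u(k), then J is lam / p
    times the sum of calF(k, u(k)).  One inequality is enough here. *)
Lemma J_ge_window (u : int -> R) (E : R) K2 : (forall k, gradient u k = 0) ->
  (forall m, \sum_(k <- window m) energy_density u k <= E) ->
  lam / p * \sum_(k <- window K2) calF p f k (u k) <= J p a b f lam u.
Proof.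
move=> gu uE; set S := \sum_(k <- _) _.
pose En := fine (energy p a b u).
have enE : energy p a b u = En%:E.
  rewrite /En fineK// ge0_fin_numE; last first.
    by rewrite energyE; apply: esum_ge0 => k _; rewrite lee_fin.
  by rewrite energyE; apply: le_lt_trans (esum_le_window (dens0 u) uE) _; rewrite ltry.
have uEn m : \sum_(k <- window m) energy_density u k <= En.
  by rewrite -lee_fin -enE energyE; exact: window_le_esum.
have work := energy_ge_work gu uEn.
have FS m : \sum_(k <- window m) F k (u k) <= (En - lam * S) / (lam * p).
  apply: le_trans (_ : \sum_(k <- window (maxn m K2)) F k (u k) <= _).
    by apply: sum_window_mono => //; exact: leq_maxl.
  rewrite ler_pdivlMr ?mulr_gt0// lerBrDr; apply: le_trans (work (maxn m K2)).
  have -> : \sum_(k <- window (maxn m K2)) f k (u k) * u k =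
     p * \sum_(k <- window (maxn m K2)) F k (u k) +
     \sum_(k <- window (maxn m K2)) calF p f k (u k).
    by rewrite mulr_sumr -big_split; apply: eq_bigr => k _ /=; rewrite /calF; ring.
  have := @sum_window_mono R K2 (maxn m K2) (fun k => calF p f k (u k)) (fun k => cal0 _ _) (leq_maxr _ _).
  by move=> /(ler_wpM2l (ltW lam0)); rewrite -/S; lra.
rewrite /J -/En.
have pos : (fun k => F k (u k))^\+ = (fun k => F k (u k)).
  by apply/funext => k; rewrite /funrpos max_l.
have neg : (fun k => F k (u k))^\- = (fun=> 0).
  by apply/funext => k; rewrite /funrneg max_r// oppr_le0.
rewrite /zsum pos neg [X in _ - fine X]esum1// subr0.
set Z := \esum_(k in _) _.
have ZB : (Z <= ((En - lam * S) / (lam * p))%:E)%E by apply: esum_le_window.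
have Z0 : (0 <= Z)%E by apply: esum_ge0 => k _; rewrite lee_fin.
have Zf : Z \is a fin_num by rewrite ge0_fin_numE//; apply: le_lt_trans ZB _; rewrite ltry.
have fZ : fine Z <= (En - lam * S) / (lam * p) by rewrite -lee_fin fineK.
have := ler_wpM2l (ltW lam0) fZ.
have -> : lam * ((En - lam * S) / (lam * p)) = p^-1 * En - lam / p * S.
  by field; rewrite !gt_eqF.
lra.
Qed.

(** The energy of a limit may drop, but the level does not: for almost critical
    points it is lam / p times the sum of calF(k, u(k)), up to a small error, and
    there the tails are uniformly small since calF(k, t) = o(|t|^p) uniformly in
    k and b is bounded below. *)
Theorem solution_above (M : R) : 0 <= M ->
  exists u, [/\ spaceX p a b u, is_solution p a b f lam u & M <= J p a b f lam u].
Proof.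
move=> M0.
have [d d0 dP] := almost_critical_points.
(* one unit is lost in the pairing of the gradient with u, one in the tails *)
pose M' := M + 2.
have dp0 : 0 < d `^ p by rewrite powR_gt0.
have [K KP] := b_oo (2 * p * M' / d `^ p).
have [|k kK|C CP] := dP K M'; first by rewrite addr_ge0.
  by rewrite ler_pdivlMl ?mulr_gt0// -ler_pdivrMr//; exact: KP.
have [E EP] := energy_bound (le_trans (normr_ge0 C) (lexx _)).
have /choice[X XP] (m : nat) : exists u, let n := (K.+1 + m)%N in
  [/\ supported n u, M' <= Jwin n.+1 u <= C,
    forall k, `|k| <= n%:Z -> `|gradient u k| <= m.+1%:R^-1 &
    `|\sum_(k <- window n.+1) gradient u k * u k| <= m.+1%:R^-1].
  set n := (K.+1 + m)%N.
  have [B B0 BP] := superlevel_bounded n.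
  pose N : R := n.*2.+1%:R.
  have N1 : 1 <= N by rewrite /N ler1n.
  (* also small enough for the pairing of the gradient with u *)
  pose eta := (m.+1%:R * (B + 1) * N)^-1.
  have m0 : 0 < m.+1%:R :> R by [].
  have eta0 : 0 < eta by rewrite invr_gt0 !mulr_gt0//; lra.
  have [|u [un uJ ug]] := CP n eta _ eta0; first by rewrite /n addSn ltnS leq_addr.
  have /andP[MJ JC] := uJ.
  have uB := BP u un (le_trans (addr_ge0 M0 (ler0n R 2)) MJ).
  have etaE : eta * ((B + 1) * N) = m.+1%:R^-1.
    by rewrite /eta; field; rewrite !gt_eqF//; lra.
  exists u; split=> // [k kn|].
    apply: le_trans (ug k kn) _; rewrite -etaE ler_peMr ?(ltW eta0)//.
    by rewrite -[leLHS]mulr1 ler_pM//; lra.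
  apply: le_trans (ler_norm_sum _ _ _) _.
  rewrite (@sum_window_widen _ n)//; last by move=> k kn; rewrite un// mulr0 normr0.
  apply: le_trans (_ : \sum_(k <- window n) eta * (B + 1) <= _).
    apply: le_sum_window => k kn; rewrite normrM ler_pM//; first exact: ug.
    by apply: le_trans (uB k) _; lra.
  by rewrite -etaE sum_window_cst -[leLHS]mulr_natr mulrA.
have XE m : \sum_(k <- window (K.+1 + m).+1) energy_density (X m) k <= E.
  have [sX /andP[MJ JC] _ gX] := XP m; apply: EP => //.
  - by apply: lt_le_trans MJ; rewrite /M'; lra.
  - by apply: le_trans JC _; exact: ler_norm.
  - by apply: le_trans gX _; rewrite invf_le1// ler1n.
have XEw m n : (m <= (K.+1 + n).+1)%N -> \sum_(k <- window m) energy_density (X n) k <= E.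
  by move=> mn; apply: le_trans (XE n); exact: sum_window_mono.
have Xb m k : b k * `|X m k| `^ p <= E.
  have [sX _ _ _] := XP m; have E0 : 0 <= E by apply: le_trans (XE m); apply: sumr_ge0.
  have [kn|kn] := leP `|k| (K.+1 + m)%:Z; last by rewrite sX// normr0 powR0 ?gt_eqF// mulr0.
  by apply: le_trans (XE m); apply: b_term_le_density; exact: le_succz.
have E0 : 0 <= E by apply: le_trans (XE 0); apply: sumr_ge0.
pose B := (E / bmin) `^ p^-1.
have XB m k : `|X m k| <= B.
  rewrite leNgt; apply/negP => BX.
  have Bp : B `^ p = E / bmin by rewrite /B -powRrM mulVf ?gt_eqF// powRr1// divr_ge0// ltW.
  have : B `^ p < `|X m k| `^ p by rewrite gt0_ltr_powR// nnegrE powR_ge0.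
  rewrite Bp ltr_pdivrMr// mulrC => h; have := lt_le_trans h (_ : _ <= b k * `|X m k| `^ p).
  by rewrite ler_wpM2r ?powR_ge0// => /(_ isT); rewrite ltNge Xb.
have [U [UU sU]] := @ultraFilterLemma nat \oo _.
have /choice[x xP] (k : int) : exists x : R, `|x| <= B /\ X n k @[n --> U] --> x.
  by apply: ultra_bounded_cvg; apply: nearW => n; exact: XB.
have Xx k : X n k @[n --> U] --> x k by have [] := xP k.
have ev (N : nat) : \forall n \near U, (N <= n)%N by apply: sU; exists N.
have gx k : gradient x k = 0.
  have lim : `|gradient (X n) k| @[n --> U] --> `|gradient x k|.
    by apply: cvg_norm; exact: grad_pointwise_continuous.
  apply/normr0_eq0/eqP; rewrite eq_le normr_ge0 andbT.
  apply/ler_addgt0Pr => e e0; rewrite add0r.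
  apply: (cvgr_to_le lim).
  apply: filterS (filterI (ev `|k|%N) (ev (Num.bound e^-1))) => n [n1 n2].
  have [_ _ /(_ k) gn _] := XP n; apply: le_trans (gn _) _.
    by rewrite -abszE lez_nat; apply: leq_trans n1 _; rewrite leq_addl.
  rewrite -[leRHS]invrK lef_pV2 ?posrE ?invr_gt0//.
  apply: ltW; apply: lt_le_trans (archi_boundP _) _; first by rewrite invr_ge0 ltW.
  by rewrite ler_nat ltnW// ltnS.
have powc (Y : nat -> R) (y : R) : Y n @[n --> U] --> y ->
    `|Y n| `^ p @[n --> U] --> `|y| `^ p.
  by move=> Yy; exact: (cvg_comp _ _ Yy (@normr_powR_continuous R p p0 y)).
have xE m : \sum_(k <- window m) energy_density x k <= E.
  have lim : \sum_(k <- window m) energy_density (X n) k @[n --> U] --> \sum_(k <- window m) energy_density x k.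
    apply: cvg_sum_seq => k; rewrite /energy_density; apply: cvgD; apply: cvgMr.
      by apply: powc; apply: cvgB.
    exact: powc.
  apply: (cvgr_to_le lim); apply: filterS (ev m) => n mn; apply: XEw.
  by rewrite leqW// (leq_trans mn)// leq_addl.
have xb k : b k * `|x k| `^ p <= E.
  by apply: le_trans (xE `|k|%N); apply: b_term_le_density; rewrite abszE.
exists x; split.
- rewrite /spaceX /= energyE; apply: le_lt_trans (esum_le_window (dens0 x) xE) _.
  by rewrite ltry.
- split; first by move=> k; have /eqP := gx k; rewrite /gradient subr_eq0 => /eqP.
  apply/cvgr0Pnorm_lt => e e0; have e20 : 0 < e / 2 by rewrite divr_gt0.
  have [K1 K1P] := vanishing_of_bound xb e20.
  exists K1%:Z => // k /= kK; apply: le_lt_trans (K1P k kK) _; lra.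
(* chosen so that the tails of calF sum to at most p / lam *)
pose eps := p / (lam * (1 + p) * (E + 1) / bmin).
have q1 : 0 < 1 + p by rewrite addr_gt0.
have qE : 0 < E + 1 by rewrite ltr_wpDl.
have eps0 : 0 < eps.
  by rewrite divr_gt0// divr_gt0// !mulr_gt0.
have [r r0 rP] := small_nonlinearity eps0.
have rp0 : 0 < r `^ p by rewrite powR_gt0.
have calr k t : `|t| <= r -> calF p f k t <= (1 + p) * eps * `|t| `^ p.
  move=> tr; have [fr Fr] := rP k t tr; rewrite /calF.
  have ft : f k t * t <= eps * `|t| `^ p.
    apply: le_trans (ler_norm _) _; rewrite normrM.
    apply: le_trans (ler_wpM2r (normr_ge0 t) fr) _.
    by rewrite -mulrA [_ * `|t|]mulrC mulr_powRB1.
  have : 0 <= p * eps * `|t| `^ p.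
    by apply: mulr_ge0; [apply: mulr_ge0; exact: ltW|exact: powR_ge0].
  have : 0 <= p * F k t by rewrite mulr_ge0 ?(ltW p0).
  lra.
have [K2 K2P] := b_oo ((E + 1) / r `^ p).
have Xr m k : K2%:Z < `|k| -> `|X m k| <= r.
  move=> kK; have := K2P k kK; rewrite ler_pdivrMr// => h; rewrite leNgt; apply/negP => rX.
  have : b k * r `^ p <= b k * `|X m k| `^ p.
    by rewrite ler_pM2l//; apply: ge0_ler_powR; rewrite ?nnegrE ?(ltW p0) ?(ltW r0) ?(ltW rX).
  by have := Xb m k; lra.
apply: le_trans (J_ge_window K2 gx xE).
have lim : lam / p * \sum_(k <- window K2) calF p f k (X n k) @[n --> U] -->
    lam / p * \sum_(k <- window K2) calF p f k (x k).
  apply: cvgMr; apply: cvg_sum_seq => k.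
  apply: (cvg_comp _ _ (Xx k)); suff : continuous (calF p f k) by apply.
  move=> t; rewrite /calF; apply: cvgB; first by apply: cvgM; [exact: hf|exact: cvg_id].
  apply: cvgMr; apply/differentiable_continuous/derivable1_diffP.
  by have := primF_derive hf k t; case.
apply: (cvgr_to_ge lim); apply: filterS (ev K2) => n K2n.
have [sX /andP[MJ JC] _ gX] := XP n.
have g1 : `|\sum_(k <- window (K.+1 + n).+1) gradient (X n) k * X n k| <= 1.
  by apply: le_trans gX _; rewrite invf_le1// ler1n.
have cs := calF_sum sX.
have tail : \sum_(k <- window (K.+1 + n).+1) calF p f k (X n k) <=
   \sum_(k <- window K2) calF p f k (X n k) +
   \sum_(k <- window (K.+1 + n).+1) (1 + p) * eps * `|X n k| `^ p.
  apply: sum_window_tail.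
  - by move=> k; apply: mulr_ge0; [apply: mulr_ge0; exact: ltW|exact: powR_ge0].
  - by move=> k kK; apply: calr; exact: Xr.
  - by rewrite leqW// (leq_trans K2n)// leq_addl.
have rest : lam * \sum_(k <- window (K.+1 + n).+1) (1 + p) * eps * `|X n k| `^ p <= p.
  rewrite -mulr_sumr.
  have S1 : bmin * \sum_(k <- window (K.+1 + n).+1) `|X n k| `^ p <= E + 1.
    apply: le_trans (_ : E <= _); last by rewrite lerDl.
    apply: le_trans (XE n); rewrite mulr_sumr; apply: ler_sum => k _.
    apply: le_trans (_ : b k * `|X n k| `^ p <= _); first by rewrite ler_wpM2r ?powR_ge0.
    by rewrite /energy_density lerDr mulr_ge0 ?powR_ge0// ltW.
  have q0 : 0 < p / (E + 1) by rewrite divr_gt0//; lra.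
  have := ler_wpM2l (ltW q0) S1.
  have -> : p / (E + 1) * (E + 1) = p by rewrite divfK// gt_eqF//; lra.
  apply: le_trans; rewrite le_eqVlt; apply/orP; left; apply/eqP.
  by rewrite /eps; field; rewrite !gt_eqF//; lra.
have := ler_wpM2l (ltW lam0) tail; rewrite mulrDr cs => T.
have gn := lerNnormlW g1; have := ler_normlW g1.
have := ler_wpM2l (ltW p0) MJ.
move: T rest; set Rs := lam * \sum_(k <- window (K.+1 + n).+1) _.
rewrite [lam / p * _]mulrAC; set Cs := lam * \sum_(k <- window K2) _; set Js := p * Jwin _ _; set Gs := \sum_(k <- _) _.
move=> T rest pMJ G1; have T2 : p * M' - 1 - p <= Cs by lra.
rewrite ler_pdivlMr//; apply: le_trans T2; have := p1; rewrite /M'; lra.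
Qed.

End Problem.

Unset Implicit Arguments.

Theorem theorem3 (R : realType) (p : R) (a b : int -> R) (f : int -> R -> R)
  (hp : 1 < p)
  (ha : forall k, 0 < a k)
  (hb : forall k, 0 < b k)
  (hf : forall k, continuous (f k))
  (hB : (exists2 b0 : R, 0 < b0 & forall k, b0 <= b k)
        /\ b k @[k --> abs_infty int] --> +oo)
  (H1 : forall (k : int) (t : R), f k (- t) = - f k t)
  (H2 : exists d q : R, [/\ 0 < d, p < q &
          forall (k : int) (t : R),
            `|primF f k t| <= d * (`|t| `^ p + `|t| `^ q)])
  (H3 : forall eps : R, 0 < eps ->
          \forall t \near (0 : R)^', forall k : int,
            `|f k t / `|t| `^ (p - 1)| < eps)
  (H4 : forall k : int,
          f k t * t / `|t| `^ p @[t --> abs_infty R] --> +oo)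
  (H5 : exists2 sigma : R, 1 <= sigma &
          forall (k : int) (t s : R), 0 <= s <= 1 ->
            calF p f k (s * t) <= sigma * calF p f k t) :
  forall lambda : R, 0 < lambda ->
    exists u : nat -> int -> R,
      (forall n : nat, spaceX p a b (u n) /\ is_solution p a b f lambda (u n))
      /\ J p a b f lambda (u n) @[n --> \oo] --> +oo.
Proof.
move=> lam lam0; have [sigma sigma1 sigmaP] := H5.
have [[bmin bmin0 bminP] b_oo'] := hB.
have b_oo (B : R) : exists K : nat, forall k : int, K%:Z < `|k| -> B <= b k.
  have /cvgryPge/(_ B)[K _ KP] := b_oo'; exists `|K|%N => k kK; apply: KP.
  by rewrite /=; apply: le_lt_trans kK; rewrite abszE ler_norm.
have /choice[u uP] (n : nat) := solution_above hp ha hb lam0 hf H1 H3 H4 sigma1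
  sigmaP bmin0 bminP b_oo (ler0n R n).
exists u; split; first by move=> n; have [] := uP n.
apply/cvgryPge => B; exists (Num.bound `|B|) => // n /= Bn.
have [_ _] := uP n; apply: le_trans; apply: le_trans (ler_norm B) _.
by apply/ltW/(lt_le_trans (archi_boundP (normr_ge0 B))); rewrite ler_nat.
Qed.
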